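(* The class of outerstring graphs is $\chi$-bounded. Equivalently: for every integer $k\geq 1$ there is a constant $C_k$ such that every grounded family of curves $\mathcal{F}$ with $\omega(\mathcal{F})\leq k$ satisfies $\chi(\mathcal{F})\leq C_k$.
   Context: A curve is a continuous image of a closed interval in the plane. The baseline is the horizontal axis; the underlying halfplane is the closed halfplane above it. A finite family of curves is grounded if each curve lies in this halfplane, has one endpoint (its basepoint) on the baseline, and meets the baseline in no other point. The intersection graph of a family of sets has the sets as vertices, two being adjacent iff they intersect. An outerstring graph is the intersection graph of a grounded family of curves. $\chi(\mathcal{F})$ and $\omega(\mathcal{F})$ denote the chromatic number and clique number of the intersection graph of $\mathcal{F}$. A class of graphs is $\chi$-bounded if there is a function $f:\mathbb{N}\to\mathbb{N}$ with $\chi(G)\leq f(\omega(G))$ for every graph $G$ in the class. *)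

(* Defs.v *)
From HB Require Import structures.
From mathcomp Require Import all_boot all_order all_algebra.
From mathcomp Require Import all_classical all_reals all_analysis.

Set Implicit Arguments.
Unset Strict Implicit.
Unset Printing Implicit Defensive.

Import Order.TTheory GRing.Theory Num.Theory.
Import numFieldNormedType.Exports.

Local Open Scope classical_set_scope.
Local Open Scope ring_scope.

Record sgraph := SGraph {
  vertex :> finType;
  adj : rel vertex;
  adj_sym : symmetric adj;
  adj_irrefl : irreflexive adj
}.

Definition isomorphic (G H : sgraph) : Prop :=
  exists2 h : G -> H, bijective h & forall x y, adj (h x) (h y) = adj x y.

Definition colorable (G : sgraph) (k : nat) : bool :=
  [exists c : {ffun G -> 'I_k},
    [forall x, forall y, adj x y ==> (c x != c y)]].

Lemma colorable_card (G : sgraph) : exists k, colorable G k.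
Proof.
exists #|G|; apply/existsP; exists [ffun x => enum_rank x].
apply/forallP => x; apply/forallP => y; apply/implyP => xy; rewrite !ffunE.
by apply: contraTneq xy => /enum_rank_inj ->; rewrite adj_irrefl.
Qed.

Definition chromatic_number (G : sgraph) : nat := ex_minn (colorable_card G).

Definition clique (G : sgraph) (K : {set G}) : bool :=
  [forall x in K, forall y in K, (x != y) ==> adj x y].

Definition clique_number (G : sgraph) : nat :=
  (\max_(K : {set G} | clique K) #|K|)%N.

Definition chi_bounded (P : sgraph -> Prop) : Prop :=
  exists f : nat -> nat,
    forall G : sgraph, P G -> (chromatic_number G <= f (clique_number G))%N.

(* Families are indexed, so members with different indices are different
   vertices even if they are equal as sets (and are then adjacent as soon as
   they are nonempty). *)
Section intersection_graph.
Context {T : finType} {X : Type} (F : T -> set X).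

Definition meets : rel T := fun i j => (i != j) && `[< F i `&` F j !=set0 >].

Lemma meets_sym : symmetric meets.
Proof. by move=> i j; rewrite /meets eq_sym setIC. Qed.

Lemma meets_irrefl : irreflexive meets.
Proof. by move=> i; rewrite /meets eqxx. Qed.

Definition intersection_graph : sgraph := SGraph meets_sym meets_irrefl.
End intersection_graph.

Section curves.
Context {R : realType}.

Definition baseline : set (R * R) := [set p | p.2 = 0].

Definition halfplane : set (R * R) := [set p | 0 <= p.2].

Definition curve_param (a b : R) (gamma : R -> R * R) (C : set (R * R)) : Prop :=
  [/\ a <= b, {within `[a, b], continuous gamma} & C = gamma @` `[a, b]].

Definition grounded_curve (C : set (R * R)) : Prop :=
  exists (a b : R) (gamma : R -> R * R) (p : R * R),
    [/\ curve_param a b gamma C,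
        C `<=` halfplane,
        p = gamma a \/ p = gamma b &
        C `&` baseline = [set p]].

Definition grounded (T : finType) (F : T -> set (R * R)) : Prop :=
  forall i, grounded_curve (F i).
End curves.

Definition outerstring (R : realType) (G : sgraph) : Prop :=
  exists (T : finType) (F : T -> set (R * R)),
    grounded F /\ isomorphic G (intersection_graph F).

(* Main.v *)
Require Import Defs.
From HB Require Import structures.
From mathcomp Require Import all_boot zify boolp.

Set Implicit Arguments.
Unset Strict Implicit.
Unset Printing Implicit Defensive.

(** The plane is used only through the crossing theorem: two continua in the
    closed half-plane that touch the baseline at interleaved points meet.  For
    points of epsilon-chains [p i], [q j] in the two sets, the parity in [i] of
    the sign changes of the height of [p i - q j] to the right of [q j] does
    not depend on [j]; interleaved ends would give it two values.

    Order the curves by basepoint.  The crossing theorem gives two facts.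
    Escape: a walk leaving the interval between adjacent [p], [p'] touches [p]
    or [p'].  Rays: if the curves of an independent set [T] all meet [v], cut
    each of them at its first point on [v]; among curves that avoid [v], on one
    side of its basepoint, the relation "y meets the shortened t" holds for one
    of [y], [w] whenever [y], [w] are adjacent and [t] lies between them, and it
    passes from [s] to every [t] between [y] and [s].

    The rest is combinatorial, by induction on the clique number, so that
    neighbourhoods have bounded chromatic number.  From a set of large chromatic
    number extract nested levels, each with a supporting set [T] inside the
    previous level: the supports lie all to the right, all to the left, or reach
    the level by rays.  By Ramsey's theorem a long subsequence of the levels is
    homogeneous, and each homogeneous type produces a clique that is too large. *)

(** * Chromatic number of vertex sets *)

Section Chi.
Variables (V : finType) (adj : rel V).

Definition ncol (n : nat) (S : {set V}) : Prop :=
  exists c : V -> nat, {in S, forall x, c x < n} /\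
    {in S &, forall x y, adj x y -> c x <> c y}.

Hypothesis adjxx : irreflexive adj.

Lemma ncol_ex (S : {set V}) : exists n, `[< ncol n S >].
Proof.
exists #|V|; apply/asboolP; exists (fun x => enum_rank x : nat); split=> [x _|x y _ _ xy].
  exact: ltn_ord.
by move=> /val_inj /enum_rank_inj E; rewrite E adjxx in xy.
Qed.

Definition chi (S : {set V}) : nat := ex_minn (ncol_ex S).

Lemma ncolW m n S : m <= n -> ncol m S -> ncol n S.
Proof. by move=> mn [c [c1 c2]]; exists c; split=> // x /c1 h; apply: leq_trans h mn. Qed.

Lemma chiP n S : reflect (ncol n S) (chi S <= n).
Proof.
rewrite /chi; case: ex_minnP => m /asboolP hm mmin; apply: (iffP idP).
  by move=> mn; apply: ncolW hm.
by move=> h; apply: mmin; apply/asboolP.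
Qed.

Lemma ncol_chi S : ncol (chi S) S.
Proof. exact/chiP. Qed.

Lemma chiS (A B : {set V}) : A \subset B -> chi A <= chi B.
Proof.
move=> /subsetP sAB; apply/chiP; have [c [c1 c2]] := ncol_chi B.
by exists c; split=> [x /sAB /c1//|x y /sAB xB /sAB]; apply: c2.
Qed.

Lemma chiU (A B : {set V}) : chi (A :|: B) <= chi A + chi B.
Proof.
have [c [c1 c2]] := ncol_chi A; have [d [d1 d2]] := ncol_chi B.
apply/chiP; exists (fun x => if x \in A then c x else chi A + d x); split=> [x|x y].
  by rewrite inE; case: ifP => [xA _|_ /= xB]; [have := c1 _ xA; lia | have := d1 _ xB; lia].
rewrite !inE; case: ifP => [xA _|_ /= xB]; case: ifP => [yA _|_ /= yB] xy.
- exact: c2.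
- by have := c1 _ xA; lia.
- by have := c1 _ yA; lia.
- by have := d2 _ _ xB yB xy; lia.
Qed.

Lemma chi0 : chi set0 = 0.
Proof. by apply/eqP; rewrite -leqn0; apply/chiP; exists (fun _ => 0); split=> x; rewrite inE. Qed.

Lemma chi1 x : chi [set x] <= 1.
Proof.
by apply/chiP; exists (fun _ => 0); split=> // a b /set1P-> /set1P->; rewrite adjxx.
Qed.

Lemma chi_le2 (S A B : {set V}) : S \subset A :|: B -> chi S <= chi A + chi B.
Proof. by move=> h; apply: leq_trans (chiS h) (chiU _ _). Qed.

Lemma chi_gt0 S : 0 < chi S -> exists x, x \in S.
Proof. by case: (set_0Vmem S) => [->|[x xS]]; [rewrite chi0 | exists x]. Qed.

Lemma chi_bigcup (I : finType) (P : pred I) (F : I -> {set V}) (n : nat) :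
  (forall i, P i -> chi (F i) <= n) -> chi (\bigcup_(i | P i) F i) <= #|P| * n.
Proof.
move=> h; apply: (@leq_trans (\sum_(i | P i) n)); last by rewrite sum_nat_const.
apply: (@big_ind2 _ _ (fun A k => chi A <= k)) => //; first by rewrite chi0.
by move=> A a B b hA hB; apply: leq_trans (chiU _ _) _; apply: leq_add.
Qed.

Lemma chi_fibers (C : finType) (S : {set V}) (d : V -> C) (n : nat) :
  (forall a, chi [set x in S | d x == a] <= n) -> chi S <= #|C| * n.
Proof.
move=> h; apply: leq_trans (chi_bigcup (P := xpredT) (fun i _ => h i)).
by apply/chiS/subsetP => x xS; apply/bigcupP; exists (d x); rewrite ?inE ?xS ?eqxx.
Qed.

Lemma chi_pigeon (C : finType) (S : {set V}) (d : V -> C) (n : nat) :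
  #|C| * n < chi S -> exists a, n < chi [set x in S | d x == a].
Proof.
move=> h; apply: contrapT => /forallNP h'; move: h; apply/negP; rewrite -leqNgt.
by apply: (chi_fibers (d := d)) => a; rewrite leqNgt; apply/negP/h'.
Qed.

(** No edge joins two classes, so one palette serves them all. *)
Lemma chi_classes (C : eqType) (S : {set V}) (d : V -> C) (n : nat) :
  {in S &, forall x y, adj x y -> d x = d y} ->
  (forall a, chi [set x in S | d x == a] <= n) -> chi S <= n.
Proof.
move=> dadj h.
have /choice[c hc] : forall a, exists c : V -> nat,
    {in [set x in S | d x == a], forall x, c x < n} /\
    {in [set x in S | d x == a] &, forall x y, adj x y -> c x <> c y}.
  by move=> a; apply/chiP.
apply/chiP; exists (fun x => c (d x) x); split=> [x xS|x y xS yS xy].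
  by apply: (hc (d x)).1; rewrite inE xS eqxx.
rewrite -(dadj x y xS yS xy); apply: (hc (d x)).2 => //; rewrite inE ?xS ?eqxx //.
by rewrite yS (dadj x y xS yS xy) eqxx.
Qed.

(** Among grades of one parity, edges stay within a grade, so [chi_classes] applies; the two
    parities get disjoint palettes. *)
Lemma chi_graded (S : {set V}) (d : V -> nat) (n : nat) : symmetric adj ->
  {in S &, forall x y, adj x y -> d x <= (d y).+1} ->
  (forall a, chi [set x in S | d x == a] <= n) -> chi S <= n.*2.
Proof.
move=> sym dadj h; rewrite -addnn.
have E : S \subset [set x in S | odd (d x)] :|: [set x in S | ~~ odd (d x)].
  by apply/subsetP => x xS; rewrite !inE xS /=; case: odd.
apply: leq_trans (chi_le2 E) _.
have par (b : bool) : chi [set x in S | odd (d x) == b] <= n.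
  apply: (chi_classes (d := d)) => [x y|a].
    rewrite !inE => /andP[xS /eqP ox] /andP[yS /eqP oy] xy.
    have h1 := dadj _ _ xS yS xy; have h2 := dadj y x yS xS; rewrite sym in h2.
    have {}h2 := h2 xy.
    have : odd (d x) = odd (d y) by rewrite ox oy.
    by move: h1 h2; lia.
  by apply: leq_trans (h a); apply/chiS/subsetP => x; rewrite !inE => /andP[/andP[-> _] ->].
apply: leq_add.
  apply: leq_trans (par true); apply/chiS/subsetP => x; rewrite !inE.
  by case/andP=> -> ->.
apply: leq_trans (par false); apply/chiS/subsetP => x; rewrite !inE.
by case/andP=> -> /negbTE ->.
Qed.

End Chi.

(** * Ordered graphs *)

Section Ordered.
Variables (V : finType) (adj : rel V).
Hypotheses (adjC : symmetric adj) (adjxx : irreflexive adj).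
Variable ord : V -> nat.
Hypothesis ord_inj : injective ord.
Local Notation chi := (chi adjxx).

Definition itv (p q : nat) (S : {set V}) : {set V} := [set z in S | p <= ord z < q].

Definition between (x t y : V) : bool :=
  (ord x < ord t < ord y) || (ord y < ord t < ord x).

Definition bset (S : {set V}) (x y : V) : {set V} := [set z in S | between x z y].

Lemma chi_itvS p e S : chi (itv p e.+1 S) <= (chi (itv p e S)).+1.
Proof.
case: (pickP [pred z | ord z == e]) => [z /= /eqP ze|h].
  apply: leq_trans (_ : chi (itv p e S) + chi [set z] <= _).
    apply: chi_le2; apply/subsetP => x; rewrite !inE => /andP[-> /andP[px xe]] /=.
    by rewrite px /= -(inj_eq ord_inj) ze; move: xe; lia.
  by rewrite -[leqRHS]addn1 leq_add2l chi1.
apply: leqW; apply/chiS/subsetP => x; rewrite !inE => /andP[-> /andP[-> xe]] /=.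
by have := h x; rewrite /=; lia.
Qed.

(** A discrete intermediate value argument: moving the right end by one position adds at most one
    vertex, hence at most one colour. *)
Lemma chi_prefix p q n S : p <= q -> n <= chi (itv p q S) ->
  exists2 e, p <= e <= q & chi (itv p e S) = n.
Proof.
move=> pq nS.
have ex : exists e, n <= chi (itv p e S) by exists q.
case: (ex_minnP ex) => e he emin.
case: (leqP e p) => [ep|pe].
  exists p; first by rewrite leqnn.
  have E0 : itv p p S = set0 by apply/setP => x; rewrite !inE; lia.
  have : itv p e S = set0 by apply/setP => x; rewrite !inE; lia.
  by move=> E; move: he; rewrite E E0 !chi0; lia.
exists e; first by rewrite ltnW //= emin.
case: e he emin pe => // e he emin pe.
apply/eqP; rewrite eqn_leq he andbT; apply: leq_trans (chi_itvS _ _ _) _.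
by rewrite ltnNge; apply/negP => /emin; rewrite ltnn.
Qed.

(* [blk j e]: before position [e] there are [j] consecutive blocks of [X] of
   chromatic number above [m].  The largest such [j] changes by at most one along
   edges spanning little of [X], so it grades the graph. *)
Section Blocks.
Variables (X : {set V}) (m : nat).

Fixpoint blk (j e : nat) : Prop :=
  if j is i.+1 then exists e1, [/\ e1 <= e, blk i e1 & m < chi (itv e1 e X)] else True.

Lemma blkW j e e' : e <= e' -> blk j e -> blk j e'.
Proof.
case: j => // j ee' [e1 [h1 h2 h3]]; exists e1; split=> //; first exact: leq_trans ee'.
apply: leq_trans h3 _; apply/chiS/subsetP => z; rewrite !inE => /andP[-> /andP[-> h]].
exact: leq_trans ee'.
Qed.

Lemma blk_pred j e : blk j.+1 e -> blk j e.
Proof. by case=> e1 [h1 h2 _]; apply: blkW h2. Qed.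

Lemma blk_le j e : blk j e -> j <= e.
Proof.
elim: j e => // j IH e [e1 [h1 /IH h2 h3]].
suff : e1 != e by lia.
apply: contraTneq h3 => ->; rewrite -leqNgt.
suff -> : itv e e X = set0 by rewrite chi0.
by apply/setP => z; rewrite !inE; lia.
Qed.

Definition blkd (x : V) : nat :=
  \max_(j < (ord x).+1 | `[< blk j (ord x) >]) j.

Lemma blkdP x j : blk j (ord x) <-> j <= blkd x.
Proof.
split=> [h|h].
  have jx : j < (ord x).+1 by rewrite ltnS; apply: blk_le.
  by apply: (@bigop.leq_bigmax_cond _ _ _ (Ordinal jx)); apply/asboolP.
have h0 : `[< blk (@ord0 (ord x)) (ord x) >] by apply/asboolP.
have [/= i /asboolP hi E] : {i0 : 'I_(ord x).+1 | `[< blk i0 (ord x) >] & blkd x = i0}.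
  by apply: eq_bigmax_cond; apply/card_gt0P; exists ord0.
rewrite E in h; move: h hi; move: (nat_of_ord i) => {E} n; elim: n => [|n IH].
  by case: j.
by rewrite leq_eqVlt ltnS => /orP[/eqP->//|h] /blk_pred; apply: IH.
Qed.

Lemma chi_blocks (S : {set V}) : S \subset X ->
  {in S &, forall x y, adj x y -> ord x < ord y -> chi (bset X x y) <= m} ->
  chi S <= (m.+1).*2.
Proof.
move=> /subsetP SX hS.
(* If the grade rose by two, the last block would start after [x], by maximality of [blkd x], and
   would lie inside [bset X x y]. *)
have key x y : x \in S -> y \in S -> adj x y -> ord x < ord y -> blkd y <= (blkd x).+1.
  move=> xS yS xy lxy; rewrite leqNgt; apply/negP => /blkdP [e1 [h1 h2 h3]].
  have xe : ord x < e1.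
    rewrite ltnNge; apply/negP => e1x.
    have /blkdP : blk (blkd x).+1 (ord x) by apply: (@blkW (blkd x).+1 _ _ e1x).
    by rewrite ltnn.
  have := hS _ _ xS yS xy lxy; rewrite leqNgt => /negP; apply; apply: leq_trans h3 _.
  apply/chiS/subsetP => z; rewrite !inE /between => /andP[-> /= h].
  by lia.
apply: (chi_graded (d := blkd)) => //.
  move=> x y xS yS xy; case: (ltngtP (ord x) (ord y)) => [l|l|/ord_inj E].
  - have : blkd x <= blkd y.
      by apply/blkdP; apply: (blkW (ltnW l)); apply/blkdP.
    by lia.
  - by apply: key => //; rewrite adjC.
  - by rewrite E adjxx in xy.
move=> a; set A := [set x in S | _].
case: (set_0Vmem A) => [->|[x0 x0A]]; first by rewrite chi0.
case: (arg_minnP ord x0A) => x xA xmin; case: (arg_maxnP ord x0A) => y yA ymax.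
(* More than [m] colours from [x] up to [y] would give [y] one block more than [x]; the additional
   colour is for [y] itself. *)
apply: (@leq_trans (chi (itv (ord x) (ord y) X) + chi [set y])).
  apply: chi_le2; apply/subsetP => z zA; rewrite !inE.
  have xz := xmin _ zA; have zy := ymax _ zA.
  move: zA; rewrite inE => /andP[/SX -> _] /=.
  by rewrite -(inj_eq ord_inj); move: xz zy; lia.
rewrite -[leqRHS]addn1; apply: leq_add; last exact: chi1.
rewrite leqNgt; apply/negP => h.
have xy : ord x <= ord y by apply: xmin.
have : x \in A by []; have : y \in A by [].
rewrite /A !inE => /andP[_ /eqP ya] /andP[_ /eqP xa].
have /blkdP : blk a.+1 (ord y).
  by exists (ord x); split=> //; apply/blkdP; rewrite xa.
by rewrite ya ltnn.
Qed.

End Blocks.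
End Ordered.

(** * Combinatorial consequences of the crossing theorem *)

Section CrossingProperties.
Variables (V : finType) (adj : rel V) (ord : V -> nat).
Local Notation btw := (between ord).

Definition escape_property : Prop := forall p p' x s,
  adj p p' -> ord p < ord x < ord p' -> path adj x s ->
  (ord (last x s) < ord p) || (ord p' < ord (last x s)) ->
  exists2 u, u \in x :: s & [|| u == p, u == p', adj u p | adj u p'].

Definition ray_rel (P T : {set V}) (E : rel V) : Prop :=
  [/\ {in P & T, forall y t, E y t -> adj y t},
      forall y w t, y \in P -> w \in P -> t \in T -> adj y w -> btw y t w -> E y t || E w t &
      forall y s t, y \in P -> s \in T -> t \in T -> E y s -> btw y t s -> E y t].

(** When [X] lies on one side of [v], so does every member of [inner T X]. The third clause of
    [ray_rel] rests on this position of [s]. *)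
Definition inner (T X : {set V}) : {set V} :=
  [set t in T | [exists x in X, exists y in X, ord x < ord t < ord y]].

Definition ray_property : Prop := forall v (T X : {set V}),
  {in T, forall t, adj v t} -> {in T &, forall s t, ~~ adj s t} ->
  {in X, forall x, (x != v) && ~~ adj v x} ->
  {in X, forall x, ord v < ord x} \/ {in X, forall x, ord x < ord v} ->
  exists E : rel V, ray_rel X (inner T X) E.

End CrossingProperties.

(** * Extraction of one level with its supports *)

Section Level.
Variables (V : finType) (adj : rel V).
Hypotheses (adjC : symmetric adj) (adjxx : irreflexive adj).
Variable ord : V -> nat.
Hypothesis ord_inj : injective ord.
Local Notation chi := (chi adjxx).
Local Notation btw := (between ord).
Local Notation bset := (bset ord).
Hypothesis esc : escape_property adj ord.
Hypothesis ray : ray_property adj ord.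
Variable xi : nat.
Hypothesis nbr : forall v, chi [set x | adj v x] <= xi.

Lemma escape_btw p p' x s :
  adj p p' -> btw p x p' -> path adj x s ->
  (ord (last x s) < ord p) && (ord (last x s) < ord p') ||
  (ord p < ord (last x s)) && (ord p' < ord (last x s)) ->
  exists2 u, u \in x :: s & [|| u == p, u == p', adj u p | adj u p'].
Proof.
move=> pp' /orP[] h ps out.
  by apply: esc => //; move: out h; lia.
have p'p : adj p' p by rewrite adjC.
have out' : (ord (last x s) < ord p') || (ord p < ord (last x s)) by move: out h; lia.
have [u us hu] := esc p'p h ps out'.
by exists u => //; case/or4P: hu => ->; rewrite ?orbT.
Qed.

(** No edge joins two components, so one of them has the chromatic number of the whole set. *)
Lemma best_component (X : {set V}) : exists K : {set V},
  [/\ K \subset X, chi X <= chi K & {in K &, forall x y, exists s,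
     [/\ path adj x s, last x s = y & {subset x :: s <= K}]}].
Proof.
case: (posnP (chi X)) => [X0|Xpos].
  by exists set0; rewrite sub0set X0; split=> // x y; rewrite inE.
pose e := [rel x y | [&& x \in X, y \in X & adj x y]].
have eC : symmetric e by move=> x y /=; rewrite adjC andbCA.
have cC : connect_sym e by apply: sym_connect_sym.
have [a ha] : exists a, chi X <= chi [set x in X | root e x == a].
  apply: contrapT => /forallNP h.
  have : chi X <= (chi X).-1; last by lia.
  apply: (chi_classes (d := root e)) => [x y xX yX xy|a].
    by apply/(rootP cC)/connect1; rewrite /= xX yX.
  by have := h a; lia.
exists [set x in X | root e x == a]; split=> //.
  by apply/subsetP => x; rewrite inE => /andP[].
move=> x y; rewrite !inE => /andP[xX /eqP xa] /andP[yX /eqP ya].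
have /connectP[s ps Es] : connect e x y by apply/(rootP cC); rewrite xa ya.
exists s; split=> //.
  by apply: sub_path ps => u w /and3P[].
move=> u us; rewrite inE.
have cu := path_connect ps us.
rewrite -xa; apply/andP; split; last by apply/eqP/esym/(rootP cC).
move: us; rewrite inE => /orP[/eqP->//|us].
case/splitPr: us ps => s1 s2; rewrite cat_path /= => /and3P[_ h _].
by case/and3P: h.
Qed.

(* Distance layer from the leftmost vertex of a component: a walk from [sg z] back
   to the root must escape from the edge [y w]. *)
Lemma supported_layer (X0 : {set V}) : (xi.+1).*2 < chi X0 ->
  exists (C : {set V}) (sg : V -> V),
  [/\ C \subset X0, chi X0 <= (chi C).*2,
      {in C, forall z, (sg z \in X0) && adj z (sg z)} &
      forall y w z, y \in C -> w \in C -> z \in C -> adj y w -> btw y z w ->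
        ~~ adj z y -> ~~ adj z w -> adj (sg z) y || adj (sg z) w].
Proof.
have [K [/subsetP KX XK Kconn]] := best_component X0 => hX.
have [r0 r0K] : exists x, x \in K by apply: (@chi_gt0 _ _ adjxx); lia.
case: (arg_minnP ord (r0K : [pred x in K] r0)) => r rK rmin {r0 r0K}.
have {}rK : r \in K by [].
(* [B i] is the ball of radius [i] around [r] in [K]. Below, [d] is the distance from [r], and [C] a
   distance layer carrying at least half of the chromatic number. *)
pose fix B i : {set V} := if i is j.+1 then
  B j :|: [set x in K | [exists y in B j, adj x y]] else [set r].
have BS i : B i \subset B i.+1 by rewrite /= subsetUl.
have BW i j : i <= j -> B i \subset B j.
  elim: j => [|j IH]; first by rewrite leqn0 => /eqP->.
  by rewrite leq_eqVlt ltnS => /orP[/eqP->//|/IH h]; apply: subset_trans h (BS j).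
have BK i : B i \subset K.
  elim: i => [|i IH]; first by rewrite sub1set.
  by rewrite /= subUset IH /=; apply/subsetP => x; rewrite inE => /andP[].
have Badj i x y : x \in K -> y \in B i -> adj x y -> x \in B i.+1.
  move=> xK yB xy; rewrite /= !inE xK /=; apply/orP; right.
  by apply/existsP; exists y; rewrite yB.
have Bex x : x \in K -> exists i, x \in B i.
  move=> xK; have [s [ps <-]] := Kconn _ _ rK xK.
  elim/last_ind: s ps => [|s y IH] ps sK; first by exists 0; rewrite /= inE.
  move: ps; rewrite rcons_path => /andP[ps ry].
  have [|i hi] := IH ps; first by move=> u us; apply: sK; rewrite -rcons_cons mem_rcons inE us orbT.
  exists i.+1; rewrite last_rcons; apply: (Badj _ _ (last r s)) => //; last by rewrite adjC.
  by apply: sK; rewrite -rcons_cons mem_rcons inE eqxx.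
have /choice[d hd] : forall x, exists n, x \in K -> x \in B n /\ forall i, x \in B i -> n <= i.
  move=> x; case: (boolP (x \in K)) => [xK|]; last by exists 0.
  case: (ex_minnP (Bex x xK)) => n h1 h2; exists n => _; split=> //.
have [a ha] : exists a, chi K <= (chi [set x in K | d x == a]).*2.
  apply: contrapT => /forallNP h.
  have : chi K <= ((chi K).-1./2).*2; last by lia.
  apply: (chi_graded (d := d)) => // [x y xK yK xy|a]; last by have := h a; lia.
  have [xB xm] := hd _ xK; have [yB ym] := hd _ yK.
  by apply: xm; apply: Badj yB xy.
set C := [set x in K | d x == a] in ha.
have CK x : x \in C -> x \in K by rewrite inE => /andP[].
have CB x i : x \in C -> x \in B i -> a <= i.
  rewrite inE => /andP[xK /eqP <-]; exact: (hd _ xK).2.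
have CBa x : x \in C -> x \in B a.
  rewrite inE => /andP[xK /eqP <-]; exact: (hd _ xK).1.
have hC : xi.+1 < chi C by move: hX XK ha; rewrite -!mul2n; clear; lia.
(* Layers 0 and 1 lie in [[set r]] and in the neighbourhood of [r], too small for [hC]. So the layer
   is [b.+2], and its supports lie in [B b.+1]. *)
case: a => [|[|b]] in C ha CK CB CBa hC *.
- suff : chi C <= 1 by lia.
  apply: leq_trans (chi1 adjxx r); apply/chiS/subsetP => x /CBa //.
- suff : chi C <= xi by lia.
  apply: leq_trans (nbr r); apply/chiS/subsetP => x xC.
  have := CBa _ xC; rewrite /= !inE => /orP[/eqP E|/andP[_ /existsP[y /andP[]]]].
    by have := CB _ 0 xC; rewrite /= E inE eqxx; lia.
  by rewrite inE => /eqP->; rewrite adjC.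
have walk i x : x \in B i -> exists s, [/\ path adj x s, last x s = r & {subset x :: s <= B i}].
  elim: i x => [|i IH] x.
    by move=> /set1P->; exists [::]; split=> // u; rewrite inE => /eqP->; rewrite inE.
  rewrite /= !inE => /orP[/IH[s [h1 h2 h3]]|/andP[xK /existsP[y /andP[yB xy]]]].
    by exists s; split=> // u /h3; apply/subsetP/BS.
  have [s [h1 h2 h3]] := IH _ yB; exists (y :: s); split=> //=; first by rewrite xy.
  move=> u; rewrite inE => /orP[/eqP->|/h3]; last exact/subsetP/BS.
  exact: Badj yB xy.
have /choice[sg hsg] : forall z, exists y, z \in C -> y \in B b.+1 /\ adj z y.
  move=> z; case: (boolP (z \in C)) => [zC|]; last by exists z.
  have := CBa _ zC; rewrite [B _]/= 2!inE => /orP[h|/andP[_ /existsP[y /andP[yB zy]]]].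
    by have := CB _ b.+1 zC; rewrite ltnn => /(_ h).
  by exists y.
exists C, sg; split.
- by apply/subsetP => x /CK /KX.
- exact: leq_trans XK ha.
- move=> z zC; have [h1 ->] := hsg _ zC; rewrite andbT; apply: KX.
  exact: (subsetP (BK b.+1)).
move=> y w z yC wC zC yw yzw zy zw.
have [hB zsz] := hsg _ zC.
have [s [ps ls sB]] : exists s, [/\ path adj (sg z) s, last (sg z) s = r & {subset s <= B b}].
  move: (hB); rewrite /= !inE => /orP[/walk[s [h1 h2 h3]]|/andP[xK /existsP[u /andP[uB xu]]]].
    by exists s; split=> // u us; apply: h3; rewrite inE us orbT.
  by have [s [h1 h2 h3]] := walk _ _ uB; exists (u :: s); split=> //=; rewrite xu.
have rlt x : x \in C -> ord r < ord x.
  move=> xC; have xK := CK _ xC; have := rmin _ xK; rewrite leq_eqVlt => /orP[/eqP/ord_inj E|//].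
  by have := CB _ 0 xC; rewrite -E /= inE eqxx => /(_ isT).
have [||u] := @escape_btw y w z (sg z :: s) yw yzw.
- by rewrite /= zsz.
- by rewrite /= ls !rlt.
(* The walk continues from [sg z] inside [B b], at distance at least two from the layer, so only
   [sg z] can touch [y] or [w]. *)
have bad x u' : x \in C -> u' \in B b -> (u' == x) || adj u' x -> False.
  move=> xC uB /orP[/eqP E|ux].
    by have := CB _ b xC; rewrite -E => /(_ uB); clear; lia.
  have : x \in B b.+1 by apply: (Badj b x u') => //; [exact: CK | rewrite adjC].
  by move/(CB _ _ xC); rewrite ltnn.
have bad2 x : x \in C -> sg z == x -> False.
  by move=> xC /eqP E; have := CB _ b.+1 xC; rewrite -E ltnn => /(_ hB).
rewrite inE => /orP[/eqP->|]; last rewrite inE => /orP[/eqP->|/sB uB].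
- case/or4P => [/eqP E|/eqP E|h|h].
  + by move: yzw; rewrite E /btw; clear; lia.
  + by move: yzw; rewrite E /btw; clear; lia.
  + by rewrite h in zy.
  + by rewrite h in zw.
- by case/or4P => [/(bad2 _ yC)|/(bad2 _ wC)|->|->]; rewrite ?orbT.
case/or4P => h.
- by case: (bad _ _ yC uB); rewrite h.
- by case: (bad _ _ wC uB); rewrite h.
- by case: (bad _ _ yC uB); rewrite h orbT.
- by case: (bad _ _ wC uB); rewrite h orbT.
Qed.

(** By [chi_blocks] some edge [a b] of the layer has many layer vertices between its ends. Those
    that avoid [a] and [b] have supports adjacent to [a] or to [b]; [v] is the end serving many of
    them. Pigeonhole on a colouring of the neighbourhood of [v] makes the supports independent. *)
Lemma star_supported (X0 : {set V}) (c : nat) :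
  8 * (xi.+1 * c + xi.+1) < chi X0 ->
  exists v (T X : {set V}) (sg : V -> V),
  [/\ X \subset X0, T \subset X0, c < chi X &
   [/\ {in T, forall t, adj v t}, {in T &, forall s t, ~~ adj s t},
      {in X, forall x, (x != v) && ~~ adj v x},
      {in X, forall x, ord v < ord x} \/ {in X, forall x, ord x < ord v} &
      {in X, forall x, (sg x \in T) && adj x (sg x)}]].
Proof.
move=> hX.
have [|C [sg [CX XC hsg sup]]] := @supported_layer X0; first by lia.
(* Room for the neighbourhoods of [a] and [b] and for [xi.+1 * c] at either end. *)
pose m := (xi.+1 * c).*2 + xi.*2.
have [a [b [aC bC ab ltab hm]]] : exists a b,
    [/\ a \in C, b \in C, adj a b, ord a < ord b & m < chi (bset C a b)].
  apply: contrapT => h.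
  have : chi C <= (m.+1).*2; last by rewrite /m; lia.
  apply: (@chi_blocks _ _ adjC adjxx _ ord_inj C) => // x y xC yC xy lxy.
  by rewrite leqNgt; apply/negP => h'; apply: h; exists x, y.
pose Z v := [set z in bset C a b | [&& ~~ adj a z, ~~ adj b z & adj v (sg z)]].
have [v [vab hv]] : exists v, (v = a \/ v = b) /\ xi.+1 * c < chi (Z v).
  apply: contrapT => h.
  have ha : chi (Z a) <= xi.+1 * c.
    by rewrite leqNgt; apply/negP => h'; apply: h; exists a; split; [left|].
  have hb : chi (Z b) <= xi.+1 * c.
    by rewrite leqNgt; apply/negP => h'; apply: h; exists b; split; [right|].
  suff : chi (bset C a b) <= (xi + xi) + (chi (Z a) + chi (Z b)) by move: hm; rewrite /m; lia.
  apply: (@leq_trans (chi ([set x | adj a x] :|: [set x | adj b x]) + chi (Z a :|: Z b))).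
    apply: chi_le2; apply/subsetP => z zC; have := zC; rewrite !inE => /andP[zC' azb].
    rewrite zC' azb /=; case: (boolP (adj a z)) => //= az; case: (boolP (adj b z)) => //= bz.
    have := sup a b z aC bC zC' ab azb; rewrite ![adj z _]adjC => /(_ az bz).
    by rewrite ![adj (sg z) _]adjC.
  apply: leq_add; last exact: chiU.
  by apply: leq_trans (chiU _ _ _) _; apply: leq_add.
have [col [col1 col2]] : ncol adj xi [set x | adj v x] by apply/(chiP adjxx).
have [i hi] : exists i : 'I_xi.+1,
    c < chi [set z in Z v | inord (col (sg z)) == i :> 'I_xi.+1].
  by apply: (@chi_pigeon _ _ adjxx _ (Z v) (fun z => inord (col (sg z)) : 'I_xi.+1)); rewrite card_ord.
set X := [set z in Z v | _] in hi.
have XP x : x \in X -> [/\ x \in C, btw a x b, ~~ adj a x & ~~ adj b x] /\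
    (adj v (sg x) /\ inord (col (sg x)) = i :> 'I_xi.+1).
  by rewrite !inE => /andP[/andP[/andP[-> ->] /and3P[-> -> ->]] /eqP].
exists v, (sg @: X), X, sg; split=> //.
- by apply/subsetP => x /XP[[xC _ _ _] _]; apply: (subsetP CX).
- by apply/subsetP => _ /imsetP[x /XP[[xC _ _ _] _] ->]; case/andP: (hsg _ xC).
split.
- by move=> _ /imsetP[x /XP[_ [h _]] ->].
- move=> _ _ /imsetP[x /XP[_ [h1 h2]] ->] /imsetP[y /XP[_ [h3 h4]] ->]; apply/negP => h.
  have n1 : sg x \in [set z | adj v z] by rewrite inE.
  have n2 : sg y \in [set z | adj v z] by rewrite inE.
  apply: (col2 _ _ n1 n2 h).
  have : inord (col (sg x)) = inord (col (sg y)) :> 'I_xi.+1 by rewrite h2 h4.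
  move/(congr1 val); rewrite /= !inordK //; first exact: leqW (col1 _ n2).
  exact: leqW (col1 _ n1).
- move=> x /XP[[xC axb ax bx] _].
  case: vab => ->; rewrite ?ax ?bx andbT; apply: contraTneq axb => ->; rewrite /btw; lia.
- case: vab => ->; [left|right] => x /XP[[_ axb _ _] _]; move: axb; rewrite /btw; lia.
- by move=> x xX; rewrite imset_f //=; have [[xC _ _ _] _] := XP _ xX; case/andP: (hsg _ xC).
Qed.

Definition out_rel (P T : {set V}) (sg : V -> V) : Prop :=
  {in P, forall x, (sg x \in T) && adj x (sg x)} /\
  forall y w z, y \in P -> w \in P -> z \in P -> adj y w -> btw y z w ->
        ~~ adj z y -> ~~ adj z w -> adj (sg z) y || adj (sg z) w.

(** If more than [c] colours are needed for the vertices that meet an inner ray, these form a ray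
    level. Otherwise a component [K] of the rest still needs more than [3 * c]. No member of [T]
    lies between two vertices of [K], so each support is to the right or to the left of all of [K],
    and one of the two sides is kept. *)
Lemma level (X0 : {set V}) (c : nat) :
  8 * (xi.+1 * (4 * c) + xi.+1) < chi X0 ->
  exists P T : {set V}, [/\ P \subset X0, T \subset X0, c < chi P &
    [\/ exists2 E, ray_rel adj ord P T E & {in P, forall x, exists2 t, t \in T & E x t},
        exists2 sg, out_rel P T sg & {in P &, forall x y, ord y < ord (sg x)} |
        exists2 sg, out_rel P T sg & {in P &, forall x y, ord (sg x) < ord y}]].
Proof.
move=> /star_supported[v [T [X [sg [XX0 TX0 hX [vT Tind vX vside hsg]]]]]].
have [E [E4 E1 E2]] := ray vT Tind vX vside.
pose X1 := [set x in X | [exists t in inner ord T X, E x t]].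
have inT t : t \in inner ord T X -> t \in T by rewrite inE => /andP[].
case: (leqP (chi X1) c) => hX1; last first.
  exists X1, (inner ord T X); split=> //.
  - by apply: subset_trans XX0; apply/subsetP => x; rewrite inE => /andP[].
  - by apply: subset_trans TX0; apply/subsetP.
  have X1X x : x \in X1 -> x \in X by rewrite inE => /andP[].
  constructor 1; exists E.
    split.
    + by move=> x t /X1X; apply: E4.
    + by move=> y w t /X1X yX /X1X wX; apply: E1.
    + by move=> y s t /X1X yX; apply: E2.
  by move=> x; rewrite inE => /andP[_ /existsP[t /andP[h1 h2]]]; exists t.
have [K [/subsetP KX2 XK Kconn]] := best_component (X :\: X1).
have KX x : x \in K -> x \in X by move/KX2; rewrite inE => /andP[].
have KE x t : x \in K -> t \in inner ord T X -> ~~ E x t.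
  move=> xK tT; have := KX2 _ xK; rewrite inE (KX _ xK) andbT; apply: contraNN => h.
  by rewrite inE KX //=; apply/existsP; exists t; rewrite tT.
have hK : 3 * c < chi K.
  have : chi X <= chi X1 + chi (X :\: X1).
    by apply: chi_le2; apply/subsetP => x xX; rewrite in_setU in_setD xX andbT orbN.
  by lia.
have sT x : x \in K -> sg x \in T by move/KX/hsg/andP=> [].
have induced x : x \in K -> adj x (sg x) by move/KX/hsg/andP=> [].
have TX t : t \in T -> t \notin X.
  by move=> tT; apply/negP => /vX; rewrite vT // andbF.
(* A walk in [K] from [x] to [y] has an edge jumping over [t]; by the second clause of [ray_rel] one
   of its ends meets the ray, against [KE]. *)
have noin x y t : x \in K -> y \in K -> t \in T -> ord x < ord t < ord y -> False.
  move=> xK yK tT xty.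
  have tin : t \in inner ord T X.
    rewrite inE tT /=; apply/existsP; exists x; rewrite KX //=.
    by apply/existsP; exists y; rewrite KX.
  have [s [ps ls sK]] := Kconn _ _ xK yK.
  elim: s x xK xty ps ls sK => [|u s IH] x xK xty /=; first by move=> _ E0; move: xty; rewrite E0; lia.
  case/andP=> xu ps ls sK.
  have uK : u \in K by apply: sK; rewrite !inE eqxx orbT.
  case: (ltngtP (ord u) (ord t)) => h.
  - apply: (IH u) => //; first by move: xty h; clear; lia.
    by move=> w wus; apply: sK; rewrite inE wus orbT.
  - have := @E1 x u t (KX _ xK) (KX _ uK) tin xu; rewrite /btw.
    have -> : ord x < ord t < ord u by move: xty h; clear; lia.
    by move=> /(_ isT); rewrite (negbTE (KE _ _ xK tin)) (negbTE (KE _ _ uK tin)).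
  - by have := TX _ tT; rewrite -(ord_inj h) KX.
have side x y : x \in K -> y \in K -> ord y < ord (sg x) -> forall z, z \in K -> ord z < ord (sg x).
  move=> xK yK yx z zK; case: (ltngtP (ord z) (ord (sg x))) => // h.
    by case: (noin y z (sg x) yK zK (sT _ xK)); rewrite yx.
  by have := TX _ (sT _ xK); rewrite -(ord_inj h) KX.
(* The walk [z], [sg z], [v] escapes, since [v] is on one side of [K]. As [v] touches nothing in
   [K], it is [sg z] that touches [y] or [w]. *)
have out (P : {set V}) : P \subset K -> out_rel P T sg.
  move=> /subsetP PK; split=> [x /PK xK|y w z /PK yK /PK wK /PK zK yw yzw zy zw].
    by rewrite sT // induced.
  have [||u] := @escape_btw y w z [:: sg z; v] yw yzw.
  - by rewrite /= induced // adjC vT // sT.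
  - rewrite /=; have hy := KX _ yK; have hw := KX _ wK.
    by case: vside => vs; rewrite (vs _ hy) (vs _ hw) ?orbT.
  have vK x : x \in K -> ((v == x) = false) * (adj v x = false).
    by move=> /KX/vX/andP[h1 h2]; rewrite eq_sym (negbTE h1) (negbTE h2).
  rewrite !inE => /or3P[]/eqP->; last by rewrite !vK.
    case/or4P => [/eqP E0|/eqP E0|h|h].
    + by move: yzw; rewrite E0 /btw; clear; lia.
    + by move: yzw; rewrite E0 /btw; clear; lia.
    + by rewrite h in zy.
    + by rewrite h in zw.
  by case/or4P => [/eqP E0|/eqP E0|->|->]; rewrite ?orbT //;
    [have := TX _ (sT _ zK); rewrite E0 KX | have := TX _ (sT _ zK); rewrite E0 KX].
pose KR := [set x in K | ord x < ord (sg x)].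
have KRK : KR \subset K by apply/subsetP => x; rewrite inE => /andP[].
have KK : chi K <= chi KR + chi (K :\: KR).
  by apply: chi_le2; apply/subsetP => x xK; rewrite in_setU in_setD xK andbT orbN.
have KX0 : K \subset X0 by apply: subset_trans XX0; apply/subsetP.
case: (ltnP c (chi KR)) => hR.
  exists KR, T; split=> //; first exact: subset_trans KRK KX0.
  constructor 2; exists sg; first exact: out.
  move=> x y; rewrite !inE => /andP[xK xs] /andP[yK _]; exact: (side _ _ xK xK xs).
exists (K :\: KR), T; split=> //; last 1 first.
- constructor 3; exists sg; first by apply: out; apply: subsetDl.
  move=> x y; rewrite !inE => /andP[xR xK] /andP[yR yK].
  case: (ltngtP (ord (sg x)) (ord y)) => // h.
    by move: xR; rewrite xK /= (side _ _ xK yK h).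
  by have := TX _ (sT _ xK); rewrite (ord_inj h) KX.
- by apply: subset_trans KX0; apply: subsetDl.
- by lia.
Qed.

End Level.

(** * Ramsey's theorem *)

Lemma seq_pigeonhole (T : eqType) (C : finType) (f : T -> C) (s : seq T) (n : nat) :
  0 < #|C| -> #|C| * n <= size s -> exists c, n <= count (fun x => f x == c) s.
Proof.
move=> C0 h; apply: contrapT => /forallNP h'.
have : size s = \sum_(c : C) count (fun x => f x == c) s.
  elim: s {h h'} => [|x s IH] /=; first by rewrite big1.
  by rewrite big_split /= -IH (bigD1 (f x)) //= eqxx big1 // => i /negbTE; rewrite eq_sym => ->.
have : \sum_(c : C) count (fun x => f x == c) s <= #|C| * n.-1.
  by rewrite -sum_nat_const; apply: leq_sum => c _; have := h' c; lia.
by case: n h h' => [|n] h h'; [have [c _] := card_gt0P C0; have := h' c | nia].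
Qed.

(** The head keeps the elements that form with it a pair of its most frequent colour, and the
    recursion goes on among these. *)
Lemma end_homogeneous (C : finType) n : exists N,
  forall (col : nat -> nat -> C) (s : seq nat), uniq s -> N <= size s ->
  exists s' f, [/\ subseq s' s, size s' = n & pairwise (fun x y => col x y == f x) s'].
Proof.
elim: n => [|n [N IH]].
  by exists 0 => col s _ _; exists [::], (fun x => col x x); rewrite sub0seq.
exists (#|C| * N).+1 => col [|x s] //= /andP[xs us] hs.
have [|c hc] := @seq_pigeonhole _ _ (col x) s N _ hs.
  by apply/card_gt0P; exists (col x x).
set t := [seq y <- s | col x y == c].
have [|s' [f [h1 h2 h3]]] := IH col t (filter_uniq _ us); first by rewrite size_filter.
have st : {subset s' <= t} by apply: mem_subseq.
exists (x :: s'), (fun z => if z == x then c else f z); split=> /=.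
- by rewrite eqxx; apply: subseq_trans h1 _; apply: filter_subseq.
- by rewrite h2.
rewrite eqxx; apply/andP; split.
  by apply/allP => y /st; rewrite mem_filter => /andP[].
apply: sub_in_pairwise (allss s') h3 => y z ys zs.
suff /negbTE -> : y != x by [].
by apply: contraNneq xs => <-; have := st _ ys; rewrite mem_filter => /andP[].
Qed.

(** Pigeonhole on the colours [f] of an end-homogeneous sequence. It is decreasing because in a
    tower a larger index means a more deeply nested level, and lists of levels start with the
    innermost one. *)
Lemma ramsey (C : finType) m : exists N, forall (col : nat -> nat -> C),
  exists s c, [/\ subseq s (rev (iota 0 N)), size s = m & pairwise (fun x y => col x y == c) s].
Proof.
have [N hN] := end_homogeneous C (#|C| * m); exists N => col.
have [||s [f [h1 h2 h3]]] := hN col (rev (iota 0 N)).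
- by rewrite rev_uniq iota_uniq.
- by rewrite size_rev size_iota.
have [||c hc] := @seq_pigeonhole _ _ f s m.
- by apply/card_gt0P; exists (f 0).
- by rewrite h2.
set t := take m [seq x <- s | f x == c].
have ts : subseq t [seq x <- s | f x == c] by apply: take_subseq.
have ts' : subseq t s by apply: subseq_trans ts _; apply: filter_subseq.
exists t, c; split.
- exact: subseq_trans h1.
- by rewrite size_takel // size_filter.
apply: sub_in_pairwise (allss t) (subseq_pairwise ts' h3) => x y xt _.
by have := mem_subseq ts xt; rewrite mem_filter => /andP[/eqP ->].
Qed.

(** * Towers of levels *)

(* [LP] is the set found at this level and [LX] the part of it in which the next
   levels live; [LT] contains the supports of the vertices of [LP].  Ray levels
   use only [LE] (which vertex meets which ray), the others only [Lsg] (the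
   support of a vertex). *)
Record lev (V : finType) := Lev {
  LP : {set V}; LX : {set V}; LT : {set V}; LE : rel V; Lsg : V -> V }.

(** A round of [out_levels] consumes one level and keeps one in [k] of the others. *)
Fixpoint out_length (k j : nat) : nat := if j is i.+1 then (k * out_length k i).+1 else 1.

(** Cost of a round of [out_levels]: [xi.+1] for a prefix containing a clique of size [k],
    [2 * k * xi] for discarded neighbourhoods, and a factor counting the maps from the remaining
    levels to that clique. *)
Fixpoint out_bound (k xi j : nat) : nat :=
  if j is i.+1 then k ^ (k * out_length k i) * out_bound k xi i + xi.+1 + 2 * k * xi else 0.

Fixpoint pairs (T : Type) (R : T -> T -> Prop) (L : seq T) : Prop :=
  if L is a :: L1 then (forall b, List.In b L1 -> R a b) /\ pairs R L1 else True.

Definition alls (T : Type) (R : T -> Prop) (L : seq T) : Prop :=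
  forall b, List.In b L -> R b.

Lemma In_nth (T : Type) (x0 : T) s i : i < size s -> List.In (nth x0 s i) s.
Proof. by elim: s i => [|x s IH] [|i] //= h; [left | right; apply: IH]. Qed.

Lemma pairs_nth (T : Type) (R : T -> T -> Prop) (x0 : T) (L : seq T) (s : seq nat) :
  pairs R L -> sorted ltn s -> all (fun i => i < size L) s ->
  pairs R [seq nth x0 L i | i <- s].
Proof.
have two i j : pairs R L -> i < j -> j < size L -> R (nth x0 L i) (nth x0 L j).
  elim: L i j => [|c L IH] [|i] [|j] //= [h1 h2] ij jL; last exact: IH.
  by apply: h1; apply: In_nth.
move=> pL; elim: s => [|i s IHs] //= ps /andP[iL sL]; split; last first.
  by apply: IHs => //; apply: path_sorted ps.
have ia : all (fun x => i < x) s by apply: order_path_min ps; apply: ltn_trans.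
elim: s {IHs ps} sL ia => [|x s IHs] //= /andP[xL sL] /andP[ix ia] b [<-|]; last exact: IHs.
exact: two.
Qed.

(** * Cliques from homogeneous lists of levels *)

Section Towers.
Variables (V : finType) (adj : rel V).
Hypotheses (adjC : symmetric adj) (adjxx : irreflexive adj).
Variables k xi beta : nat.
Local Notation chi := (chi adjxx).

Definition is_clique (K : {set V}) : Prop := {in K &, forall x y, x != y -> adj x y}.

Lemma is_cliqueU1 x K : is_clique K -> {in K, forall y, adj x y} -> is_clique (x |: K) /\ #|x |: K| = #|K|.+1.
Proof.
move=> cK xK; split.
  move=> u w /setU1P[->|uK] /setU1P[->|wK] uw; [by rewrite eqxx in uw|exact: xK| |exact: cK].
  by rewrite adjC xK.
by rewrite cardsU1; case: (boolP (x \in K)) => // /xK; rewrite adjxx.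
Qed.

Hypothesis nbr : forall v, chi [set x | adj v x] <= xi.
Hypothesis noclique : forall K, is_clique K -> #|K| <= k.
Hypothesis bigclique : forall S : {set V}, xi < chi S ->
  exists K : {set V}, [/\ K \subset S, is_clique K & #|K| = k].

Definition nest (a b : lev V) : bool := (LP a \subset LX b) && (LT a \subset LX b).

Section Ord.
Variable ord : V -> nat.
Hypothesis ord_inj : injective ord.
Local Notation btw := (between ord).
Local Notation bset := (bset ord).
Local Notation itv := (itv ord).

Definition right_level (a : lev V) : Prop :=
  [/\ out_rel adj ord (LX a) (LT a) (Lsg a) & {in LX a &, forall x y, ord y < ord (Lsg a x)}].

Definition ray_level (a : lev V) : Prop :=
  [/\ ray_rel adj ord (LP a) (LT a) (LE a), LX a \subset LP a &
      forall p q, {in LT a, forall t, ~~ (p <= ord t < q)} ->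
        chi (itv p q (LX a)) <= 2 * xi].

(** The threshold [(beta.*2).+1] is two short distances and one vertex: no ray can be near both [t]
    and [t2]. *)
Definition deep_level (a : lev V) : Prop :=
  {in LX a, forall y, exists t t2, [/\ t \in LT a, t2 \in LT a, LE a y t & LE a y t2] /\
    [/\ btw y t t2, beta < chi (bset (LP a) y t) & (beta.*2).+1 < chi (bset (LP a) t t2)]}.

Definition short_pair (a b : lev V) : Prop :=
  {in LT a & LT b, forall t s, LE b t s -> chi (bset (LP a) t s) <= beta}.

Definition long_pair (a b : lev V) : Prop :=
  {in LT a, forall t, exists s, [/\ s \in LT b, LE b t s, ord t < ord s & beta < chi (bset (LP a) t s)]}.

(* [Q] is a clique adjacent to all supports of [X] in the remaining levels; each
   round thins out the levels by pigeonhole and adds a support to [Q]. *)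
Lemma out_levels j (L : seq (lev V)) (Q X : {set V}) :
  is_clique Q -> #|Q| + j = k -> size L = out_length k j ->
  pairs nest L -> alls right_level L -> alls (fun b => X \subset LX b) L ->
  alls (fun b => {in Q & X, forall q z, adj (Lsg b z) q}) L ->
  out_bound k xi j < chi X -> False.
Proof.
elim: j L Q X => [|j IH] L Q X cQ.
  rewrite addn0; case: L => [|b [|]] //= Qk _ _ _ _ hQ /chi_gt0[z zX].
  have [] := @is_cliqueU1 (Lsg b z) Q cQ.
    by move=> q qQ; apply: (hQ b) => //; left.
  by move=> /noclique; rewrite Qk => h E; move: h; rewrite E ltnn.
case: L => [|a L1] //= Qk [sL1] [nA nL1] rL XL QL hX.
have aL : List.In a (a :: L1) by left.
have inL1 b : List.In b L1 -> List.In b (a :: L1) by right.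
pose top := (\max_(x : V) ord x).+1.
have otop x : ord x < top by rewrite ltnS; apply: (leq_bigmax x).
have Etop : itv 0 top X = X by apply/setP => x; rewrite inE leq0n otop !andbT.
have hx : xi.+1 <= chi (itv 0 top X) by rewrite Etop; lia.
have [e _ he] := chi_prefix ord_inj (leq0n top) hx.
have [W [WX cW Wk]] : exists K : {set V}, [/\ K \subset itv 0 e X, is_clique K & #|K| = k].
  by apply: bigclique; rewrite he.
have WP w : w \in W -> w \in X /\ ord w < e by move/(subsetP WX); rewrite inE => /andP[].
pose bad := \bigcup_(w in W) ([set x | adj w x] :|: [set x | adj (Lsg a w) x]).
pose R := [set z in itv e top X | z \notin bad].
have hbad : chi bad <= 2 * k * xi.
  have -> : 2 * k * xi = #|W| * (xi + xi) by rewrite Wk; lia.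
  apply: chi_bigcup => w _; apply: leq_trans (chiU _ _ _) _.
  by apply: leq_add; apply: nbr.
have hR : k ^ (k * out_length k j) * out_bound k xi j < chi R.
  have h1 : chi X <= chi (itv 0 e X) + chi (itv e top X).
    by apply: chi_le2; apply/subsetP => x xX; rewrite !inE xX otop andbT /=; case: ltnP.
  have h2 : chi (itv e top X) <= chi bad + chi R.
    by apply: chi_le2; apply/subsetP => x xX; rewrite in_setU [x \in R]inE xX /= orbN.
  by move: hX h1 h2 hbad; rewrite he; lia.
have RX z : z \in R -> z \in X by rewrite !inE => /andP[/andP[]].
(* Each edge from [w] to [Lsg a w] spans [z], so the support of [z] at [b] touches one of its ends.
   If it were always [w], that support would extend [W] to a clique of size [k.+1]. *)
have hit z b : z \in R -> List.In b L1 -> exists w, (w \in W) && adj (Lsg b z) (Lsg a w).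
  move=> zR bL; apply: contrapT => /forallNP hn.
  have [[_ LO] _] := rL _ (inL1 _ bL).
  have zX := RX _ zR; have zb : z \in LX b by apply: (subsetP (XL _ (inL1 _ bL))).
  suff zW : {in W, forall w, adj (Lsg b z) w}.
    by have [cl E] := is_cliqueU1 cW zW; have := noclique cl; rewrite E Wk ltnn.
  move=> w wW; have [wX we] := WP _ wW.
  have wa : w \in LX a by apply: (subsetP (XL _ aL)).
  have za : z \in LX a by apply: (subsetP (XL _ aL)).
  have [[ha _] sd] := rL _ aL; have /andP[sT wsw] := ha _ wa.
  have wb : w \in LX b by apply: (subsetP (XL _ (inL1 _ bL))).
  have sb : Lsg a w \in LX b by have /andP[_ /subsetP h] := nA _ bL; apply: h.
  move: (zR); rewrite inE => /andP[zi zbad].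
  have ez : e <= ord z by move: zi; rewrite inE => /and3P[].
  have zw : ~~ adj z w /\ ~~ adj z (Lsg a w).
    rewrite ![adj z _]adjC; split; apply: contraNN zbad => h; apply/bigcupP; exists w => //;
    by rewrite !inE h ?orbT.
  have := LO w (Lsg a w) z wb sb zb wsw; rewrite /between.
  have -> : ord w < ord z < ord (Lsg a w) by rewrite sd // andbT (leq_trans we ez).
  move=> /(_ isT zw.1 zw.2) /orP[//|h].
  by case: (hn w); rewrite wW h.
have k0 : 0 < k by rewrite -Qk addnS.
pose Wt : finType := {w : V | w \in W}.
have cWt : #|{: Wt}| = k by rewrite card_sig -Wk; apply: eq_card.
have [w1 w1W] : exists w, w \in W by apply/card_gt0P; rewrite Wk.
pose w0 : Wt := exist _ w1 w1W.
have /choice[d hd] : forall z, exists f : {ffun 'I_(size L1) -> Wt}, z \in R ->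
    forall i : 'I_(size L1), adj (Lsg (nth a L1 i) z) (Lsg a (val (f i))).
  move=> z; case: (boolP (z \in R)) => [zR|]; last by exists [ffun=> w0].
  have /choice[f hf] : forall i : 'I_(size L1), exists w : Wt, adj (Lsg (nth a L1 i) z) (Lsg a (val w)).
    move=> i; have [|w /andP[wW h]] := @hit z (nth a L1 i) zR.
      exact: In_nth.
    by exists (exist _ w wW).
  by exists [ffun i => f i] => _ i; rewrite ffunE.
(* First pigeonhole: the kept vertices choose the same map [phi] from levels to [W]. Second: the
   kept levels have the same value [w] under [phi]. *)
have [|phi hphi] := @chi_pigeon _ _ adjxx _ R d (out_bound k xi j).
  by rewrite card_ffun card_ord cWt sL1.
have [||w hw] := @seq_pigeonhole _ _ (fun i => phi i) (enum 'I_(size L1)) (out_length k j).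
- by rewrite cWt.
- by rewrite cWt size_enum_ord sL1.
set I := take (out_length k j) [seq i <- enum 'I_(size L1) | phi i == w].
have sI : subseq I [seq i <- enum 'I_(size L1) | phi i == w] by apply: take_subseq.
pose L2 := [seq nth a L1 (val i) | i <- I].
have L2sub b : List.In b L2 -> exists2 i : 'I_(size L1), phi i = w & b = nth a L1 i.
  rewrite /L2; have : {subset I <= [pred i | phi i == w]}.
    by move=> i /(mem_subseq sI); rewrite mem_filter => /andP[].
  elim: (I) => [|i I' IHI] //= hI [<-|]; last first.
    by apply: IHI => x xI; apply: hI; rewrite inE xI orbT.
  by exists i => //; apply/eqP/hI; rewrite inE eqxx.
have L2L1 b : List.In b L2 -> List.In b L1 by move=> /L2sub[i _ ->]; apply: In_nth.
have sgw : val w \in X /\ val w \in W by split; [have [] := WP _ (valP w) | exact: valP].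
(* The invariant on [Q], taken at the level [a] and the vertex [w] of [X], makes the new support
   adjacent to all of [Q]. *)
have [c1 c2] := @is_cliqueU1 (Lsg a (val w)) Q cQ (fun q qQ => QL a aL q _ qQ sgw.1).
apply: (IH L2 (Lsg a (val w) |: Q) [set z in R | d z == phi]) => //.
- by rewrite c2; lia.
- by rewrite size_map size_takel // size_filter.
- have -> : L2 = [seq nth a L1 i | i <- map val I] by rewrite -map_comp.
  apply: pairs_nth => //.
    apply: (subseq_sorted ltn_trans) (_ : sorted ltn (iota 0 (size L1))); last exact: iota_ltn_sorted.
    rewrite -val_enum_ord; apply: map_subseq; apply: subseq_trans sI _; exact: filter_subseq.
  by apply/allP => _ /mapP[i _ ->]; apply: (ltn_ord i).
- by move=> b bL; apply: (rL b); apply/inL1/L2L1.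
- move=> b bL; apply/subsetP => z; rewrite inE => /andP[/RX zX _].
  by apply: (subsetP (XL b _)) => //; apply/inL1/L2L1.
move=> b bL2 q z qQ; rewrite inE => /andP[zR /eqP dz].
have [i phii bE] := L2sub _ bL2.
case/setU1P: qQ => [->|qQ].
  by have := hd z zR i; rewrite dz phii -bE.
by apply: (QL b); [apply/inL1/L2L1 | | exact: RX].
Qed.

(** If [t] meets a long ray [s] of a level, it meets all rays of that level between [t] and [s], by
    the third clause of [ray_rel]. Cutting the interval at such an [s] leaves more than [beta],
    hence at least [n]. *)
Lemma shrink_interval (L : seq (lev V)) (a : lev V) (t : V) (q n : nat) :
  t \in LT a -> alls ray_level L -> alls (fun b => t \in LP b) L -> alls (long_pair a) L ->
  n <= beta -> n <= chi (itv (ord t).+1 q (LP a)) ->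
  exists q', [/\ q' <= q, n <= chi (itv (ord t).+1 q' (LP a)) &
    alls (fun b => {in LT b, forall s, ord t < ord s < q' -> LE b t s}) L].
Proof.
move=> ta rL tL lL nb hq; elim: L rL tL lL => [|b L IH] rL tL lL.
  by exists q; split=> // b [].
have [q' [q'q hq' hL]] := IH (fun c cL => rL c (or_intror cL))
  (fun c cL => tL c (or_intror cL)) (fun c cL => lL c (or_intror cL)).
have [s [sT ts lts hs]] := lL b (or_introl erefl) t ta.
have [[_ _ E2] _ _] := rL b (or_introl erefl); have tb := tL b (or_introl erefl).
exists (minn q' (ord s)); split; first exact: leq_trans (geq_minl _ _) q'q.
  rewrite /minn; case: ifP => // _; apply: leq_trans nb _; apply: leq_trans (ltnW hs) _.
  apply/chiS/subsetP => z; rewrite !inE /between => /andP[-> h] /=.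
  by move: h lts; lia.
move=> c [<-|cL] u uT hu; last by apply: (hL c) => //; move: hu; rewrite leq_min; lia.
by apply: (E2 _ s) => //; rewrite /between; move: hu; rewrite leq_min; lia.
Qed.

(** Greedy growth of a clique whose members meet all rays of the remaining levels between [p] and
    [q]. A prefix needing [2 * xi + 1] colours contains a ray [t] of the first level, by the gap
    condition. It joins the clique, and [shrink_interval] restores the invariant to the right of
    [t]. *)
Lemma long_levels (L : seq (lev V)) (P K : {set V}) (p q : nat) :
  is_clique K -> pairs nest L -> pairs long_pair L -> alls ray_level L ->
  alls (fun b => P \subset LX b) L -> alls (fun b => K \subset LP b) L ->
  alls (fun b => {in K & LT b, forall u s, p <= ord s < q -> LE b u s}) L ->
  size L * (2 * xi).+1 <= chi (itv p q P) -> p <= q -> size L * (2 * xi).+1 <= beta ->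
  exists K', is_clique K' /\ #|K'| = #|K| + size L.
Proof.
elim: L P K p q => [|b L IH] P K p q cK /=.
  by move=> *; exists K; rewrite addn0.
move=> [nb nL] [lb lL] rL PL KL EL; rewrite mulSn => hp pq hb.
have bL : List.In b (b :: L) by left.
have inL c : List.In c L -> List.In c (b :: L) by right.
have [[E4 E1 E2] XPb gap] := rL _ bL.
have h2 : (2 * xi).+1 <= chi (itv p q P) by lia.
have [e /andP[pe eq_] he] := chi_prefix ord_inj pq h2.
have [t tT pte] : exists2 t, t \in LT b & p <= ord t < e.
  apply: contrapT => h.
  have : chi (itv p e P) <= 2 * xi; last by rewrite he ltnn.
  apply: leq_trans (gap p e _).
    apply/chiS/subsetP => z; rewrite !inE => /andP[zP ->].
    by rewrite (subsetP (PL _ bL)).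
  by move=> t tT; apply/negP => h'; apply: h; exists t.
have tq : p <= ord t < q by move: pte; lia.
have tK : {in K, forall u, adj t u}.
  move=> u uK; rewrite adjC; apply: E4 => //; first exact: (subsetP (KL _ bL)).
  exact: (EL b bL).
have [c1 c2] := is_cliqueU1 cK tK.
have hq : size L * (2 * xi).+1 <= chi (itv (ord t).+1 q (LP b)).
  have h3 : chi (itv p q P) <= chi (itv p e P) + chi (itv e q P).
    by apply: chi_le2; apply/subsetP => x; rewrite !inE => /andP[-> h] /=; move: h; lia.
  have h4 : chi (itv e q P) <= chi (itv (ord t).+1 q (LP b)).
    apply/chiS/subsetP => x; rewrite !inE => /andP[xP h].
    rewrite (subsetP XPb) ?(subsetP (PL _ bL)) //=; move: h pte; lia.
  by move: h3 h4; rewrite he; lia.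
have tL c : List.In c L -> t \in LP c.
  move=> cL; have [_ /subsetP XP _] := rL _ (inL _ cL).
  by apply: XP; have /andP[_ /subsetP h] := nb _ cL; apply: h.
have hb' : size L * (2 * xi).+1 <= beta by lia.
have rL' : alls ray_level L by move=> c cL; apply: rL; apply: inL.
have [q' [q'q hq' hL]] := shrink_interval tT rL' tL lb hb' hq.
(* The shrunk interval can be empty only if no level remains. *)
case: (leqP (ord t).+1 q') => [tq'|q't]; last first.
  have E0 : itv (ord t).+1 q' (LP b) = set0 by apply/setP => x; rewrite !inE; lia.
  have L0 : size L = 0 by move: hq'; rewrite E0 chi0; lia.
  by exists (t |: K); rewrite c2 L0 addn1.
have [|||K' [cK' sK']] := IH (LP b) (t |: K) (ord t).+1 q' c1 nL lL rL' _ _ _ hq' tq' hb'.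
- by move=> c cL; have /andP[] := nb _ cL.
- move=> c cL; rewrite subUset sub1set tL //=; exact: (KL c (inL _ cL)).
- move=> c cL u s /setU1P[->|uK] sT h; first by apply: (hL c).
  by apply: (EL c (inL _ cL)) => //; move: h q'q pte; lia.
by exists K'; split=> //; rewrite sK' c2 addSnnS.
Qed.

(** The recursion replaces [y] by a ray [t] of the first level that [y] meets, so [t] extends the
    clique found for it. To keep [y] in touch with a ray [u] of that clique: [u] is near [t], while
    [t] is far from [y] and from [t2], so [u] lies between [y] and [t2]. These are adjacent, so one
    of them meets [u], and [t2] is too far away to do so. *)
Lemma short_levels (L : seq (lev V)) (y : V) :
  pairs nest L -> pairs short_pair L -> alls ray_level L -> alls deep_level L ->
  alls (fun b => y \in LX b) L ->
  exists U : {set V}, [/\ is_clique U, #|U| = size L &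
    {in U, forall u, exists b, [/\ List.In b L, u \in LT b & LE b y u]}].
Proof.
elim: L y => [|a L IH] y /=.
  by move=> *; exists set0; rewrite cards0; split=> // u; rewrite inE.
move=> [na nL] [sa sL] rL dL yL.
have aL : List.In a (a :: L) by left.
have inL c : List.In c L -> List.In c (a :: L) by right.
have [t [t2 [[tT t2T yt yt2] [ytt hyt htt]]]] := dL _ aL _ (yL _ aL).
have TL s c : s \in LT a -> List.In c L -> s \in LX c.
  by move=> sT cL; have /andP[_ /subsetP h] := na _ cL; apply: h.
have [|||U [cU sU hU]] := IH t nL sL.
- by move=> c cL; apply: rL; apply: inL.
- by move=> c cL; apply: dL; apply: inL.
- by move=> c cL; apply: TL.
have [[E4a _ _] XPa _] := rL _ aL.
have yPa : y \in LP a by apply: (subsetP XPa); apply: yL.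
have tU : {in U, forall u, adj t u}.
  move=> u /hU[b [bL uT tu]]; have [[E4 _ _] XP _] := rL _ (inL _ bL).
  by apply: E4 => //; apply: (subsetP XP); apply: TL.
have [c1 c2] := is_cliqueU1 cU tU.
exists (t |: U); split=> //; first by rewrite c2 sU.
move=> u /setU1P[->|/hU[b [bL uT tu]]]; first by exists a.
exists b; split=> //; first exact: inL.
have [[E4 E1 _] XP _] := rL _ (inL _ bL).
have htu := sa _ bL _ _ tT uT tu.
have sub_u x z : {subset bset (LP a) x z <= bset (LP a) t u} -> chi (bset (LP a) x z) <= beta.
  by move=> h; apply: leq_trans htu; apply/chiS/subsetP.
have n1 : ~ {subset bset (LP a) y t <= bset (LP a) t u}.
  by move/sub_u; rewrite leqNgt hyt.
have n2 : ~ {subset bset (LP a) t t2 <= bset (LP a) t u}.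
  by move/sub_u; move: htt; clear; lia.
have yut2 : btw y u t2.
  apply/negPn/negP => nb.
  case: (boolP [|| (ord y < ord t) && (ord u <= ord y) | (ord t < ord y) && (ord y <= ord u)]) => h.
    apply: n1 => z; rewrite !inE /between => /andP[-> h'] /=.
    by move: ytt nb h h'; rewrite /between; clear; case: (ltngtP (ord y) (ord t)) => //= yt; lia.
  apply: n2 => z; rewrite !inE /between => /andP[-> h'] /=.
  by move: ytt nb h h'; rewrite /between; clear; case: (ltngtP (ord y) (ord t)) => //= yt; lia.
have yb : y \in LP b by apply: (subsetP XP); apply/yL/inL.
have t2b : t2 \in LP b by apply: (subsetP XP); apply: TL.
have /orP[//|t2u] := E1 y t2 u yb t2b uT (E4a _ _ yPa t2T yt2) yut2.
have h3 := sa _ bL _ _ t2T uT t2u.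
have : chi (bset (LP a) t t2) <= chi (bset (LP a) t u :|: bset (LP a) t2 u) + chi [set u].
  apply: chi_le2; apply/subsetP => z; rewrite !inE => /andP[-> h] /=.
  rewrite -(inj_eq ord_inj); move: ytt h yut2; rewrite /between; clear.
  by case: (ltngtP (ord z) (ord u)) => // zu; case: (ltngtP (ord y) (ord t)) => //= yt; lia.
have := chi1 adjxx u; have := chiU adjxx (bset (LP a) t u) (bset (LP a) t2 u).
by move: htt htu h3; clear; lia.
Qed.

End Ord.
End Towers.

(** * Reversal of the vertex order *)

Section Reverse.
Variables (V : finType) (adj : rel V) (adjxx : irreflexive adj) (ord : V -> nat).
Hypothesis ord_inj : injective ord.

Definition top : nat := (\max_(x : V) ord x).+1.
Definition mirror (x : V) : nat := top.-1 - ord x.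

Lemma ord_top x : ord x < top.
Proof. by rewrite ltnS; apply: (leq_bigmax x). Qed.

Lemma mirror_inj : injective mirror.
Proof.
move=> x y; rewrite /mirror => h; apply: ord_inj.
by have := ord_top x; have := ord_top y; move: h; lia.
Qed.

Lemma btw_rev x t y : between mirror x t y = between ord x t y.
Proof.
rewrite /between /mirror; have := ord_top x; have := ord_top t; have := ord_top y.
by move: (ord x) (ord y) (ord t) top => a b c n; lia.
Qed.

Lemma bset_rev S x y : bset mirror S x y = bset ord S x y.
Proof. by apply/setP => z; rewrite !inE btw_rev. Qed.

Lemma itv_rev p q S : itv mirror p q S = itv ord (top - q) (top - p) S.
Proof.
apply/setP => z; rewrite !inE /mirror; have := ord_top z.
by move: (ord z) top => a n; lia.
Qed.

Lemma ray_level_rev xi a : ray_level adjxx xi ord a -> ray_level adjxx xi mirror a.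
Proof.
move=> [[E4 E1 E2] XP gap]; split=> //.
  by split=> // [y w t|y s t]; rewrite btw_rev; [apply: E1|apply: E2].
move=> p q h; rewrite itv_rev; apply: gap => t tT; apply: contraNN (h _ tT).
rewrite /mirror; have := ord_top t.
by move: (ord t) top => a' n; lia.
Qed.

Lemma out_rel_rev P T sg : out_rel adj ord P T sg -> out_rel adj mirror P T sg.
Proof. by move=> [h1 h2]; split=> // y w z; rewrite btw_rev; apply: h2. Qed.

End Reverse.

(** * Construction of a tower of levels *)

Definition short_bound (xi beta : nat) : nat := 3 * beta + 2 * xi + 5.

(** The last line is the requirement of [level]. The factor [3 ^ n] counts the patterns of a ray
    against [n] earlier levels, and the term added to [c] is the bound of [chi_shorts]. *)
Definition step_bound (xi beta n c : nat) : nat :=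
  let c1 := 3 ^ n * (c + (2 * (short_bound xi beta).+1 + 2 * xi).+1.*2) in
  8 * (xi.+1 * (4 * c1) + xi.+1).

(** The innermost level is charged first; it is compared with the [i] levels around it. *)
Fixpoint tower_bound (xi beta n c : nat) : nat :=
  if n is i.+1 then tower_bound xi beta i (step_bound xi beta i c) else c.

Section Step.
Variables (V : finType) (adj : rel V).
Hypotheses (adjC : symmetric adj) (adjxx : irreflexive adj).
Variable ord : V -> nat.
Hypothesis ord_inj : injective ord.
Local Notation chi := (chi adjxx).
Local Notation btw := (between ord).
Local Notation bset := (bset ord).
Local Notation itv := (itv ord).
Local Notation rord := (mirror ord).
Hypothesis esc : escape_property adj ord.
Hypothesis ray : ray_property adj ord.
Variables xi beta : nat.
Hypothesis nbr : forall v, chi [set x | adj v x] <= xi.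

(* Codes: 0 short rays, 1 and 2 long rays to the right and left, 3 and 4 supports
   to the right and left. *)
Definition level_rel (c : nat) (a b : lev V) : Prop :=
  match c with
  | 0 => [/\ ray_level adjxx xi ord a, deep_level adjxx beta ord a & short_pair adjxx beta ord a b]
  | 1 => ray_level adjxx xi ord a /\ long_pair adjxx beta ord a b
  | 2 => ray_level adjxx xi ord a /\ long_pair adjxx beta rord a b
  | 3 => right_level adj ord a
  | _ => right_level adj rord a
  end.

Section Gap.
Variables (P Y T : {set V}) (E : rel V) (sg : V -> V).
Hypothesis rE : ray_rel adj ord P T E.
Hypothesis YP : Y \subset P.
Hypothesis hsg : {in Y, forall z, (sg z \in T) && E z (sg z)}.

(** The vertices in the gap whose ray lies to its left all meet the rightmost ray on the left, by
    the third clause of [ray_rel], so they lie in one neighbourhood. The other side is symmetric. *)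
Lemma chi_gap p q : {in T, forall t, ~~ (p <= ord t < q)} -> chi (itv p q Y) <= 2 * xi.
Proof.
move=> noT; have [E4 E1 E2] := rE.
pose A b := [set z in itv p q Y | (ord (sg z) < p) == b].
have hA : chi (itv p q Y) <= chi (A true) + chi (A false).
  by apply: chi_le2; apply/subsetP => z zY; rewrite in_setU !inE; move: zY; rewrite !inE => ->;
     case: (_ < p).
suff h b : chi (A b) <= xi by have := h true; have := h false; lia.
have AP z : z \in A b -> [/\ z \in P, sg z \in T, E z (sg z) & p <= ord z < q] /\ (ord (sg z) < p) = b.
  rewrite !inE => /andP[/andP[zY ->] /eqP ->].
  by have /andP[-> ->] := hsg zY; rewrite (subsetP YP).
case: (set_0Vmem (A b)) => [->|[z0 z0A]]; first by rewrite chi0.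
have [[_ s0T _ _] h0] := AP _ z0A.
pose Q := [pred t | (t \in T) && ((ord t < p) == b)].
have Q0 : Q (sg z0) by rewrite /= s0T h0 eqxx.
suff [t [tT ht]] : exists t, t \in T /\ {in A b, forall z, sg z = t \/ btw z t (sg z)}.
  apply: leq_trans (nbr t); apply/chiS/subsetP => z zA; rewrite inE adjC.
  have [[zP sT zs _] _] := AP _ zA; apply: E4 => //.
  by have [<-//|h] := ht _ zA; apply: E2 zs h.
have QA z : z \in A b -> Q (sg z).
  by move=> zA; have [[_ sT _ _] hz] := AP _ zA; rewrite /= sT hz eqxx.
case: b @A @Q hA AP z0A h0 Q0 QA => A Q hA AP z0A h0 Q0 QA.
  case: (arg_maxnP ord Q0) => t /andP[tT tp] tmax; exists t; split=> // z zA.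
  have [[_ _ _ pzq] hz] := AP _ zA; have := tmax _ (QA _ zA).
  rewrite /= leq_eqVlt => /orP[/eqP/ord_inj->|h]; [by left | right].
  by rewrite /between; move: pzq tp h; lia.
case: (arg_minnP ord Q0) => t /andP[tT tp] tmin; exists t; split=> // z zA.
have [[_ _ _ pzq] hz] := AP _ zA; have := tmin _ (QA _ zA).
rewrite leq_eqVlt => /orP[/eqP/ord_inj->|h]; [by left | right].
by have := noT _ tT; rewrite /between; move: pzq tp h; lia.
Qed.

(** For an edge [y y'], let [p] come just after the last ray between them that meets [y], and [q] be
    the first that meets [y']. The outer pieces are short, with one more colour for the ray itself.
    A ray from [p] to [q] would meet neither end, so there is none and [chi_gap] applies. The sum is
    the [m] of [chi_blocks]. *)
Lemma chi_shorts M (Sh : {set V}) : Sh \subset Y ->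
  {in Sh & T, forall y t, E y t -> chi (bset Y y t) <= M} ->
  chi Sh <= (2 * M.+1 + 2 * xi).+1.*2.
Proof.
move=> ShY hSh; apply: (@chi_blocks _ _ adjC adjxx _ ord_inj Y) => // y y' yS y'S yy' lyy'.
have [E4 E1 E2] := rE.
have [p [yp py' hp noT1]] : exists p, [/\ ord y < p, p <= ord y', chi (itv (ord y).+1 p Y) <= M.+1 &
    {in T, forall t, p <= ord t < ord y' -> ~~ E y t}].
  case: (pickP [pred t | [&& t \in T, btw y t y' & E y t]]) => [t0 h0|hn]; last first.
    exists (ord y).+1; split=> //.
      have -> : itv (ord y).+1 (ord y).+1 Y = set0 by apply/setP => z; rewrite !inE; lia.
      by rewrite chi0.
    move=> t tT h; apply/negP => Et; have := hn t; rewrite /= tT Et andbT /between.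
    by move: h; lia.
  case: (arg_maxnP ord h0) => t /and3P[tT yty' yt] tmax.
  exists (ord t).+1; split.
  - by move: yty' lyy'; rewrite /between; lia.
  - by move: yty' lyy'; rewrite /between; lia.
  - rewrite -[leqRHS]addn1; apply: leq_trans _ (leq_add (hSh _ _ yS tT yt) (chi1 adjxx t)).
    apply: chi_le2; apply/subsetP => z; rewrite !inE => /andP[-> h] /=.
    by rewrite -(inj_eq ord_inj) /between; move: h; clear; lia.
  - move=> s sT h; apply/negP => Es; have := tmax s; rewrite /= sT Es andbT.
    by rewrite /between; move: h yty'; rewrite /between; clear; lia.
have [q [yq qy' hq noT2]] : exists q, [/\ ord y < q, q <= ord y', chi (itv q (ord y') Y) <= M.+1 &
    {in T, forall t, ord y < ord t < q -> ~~ E y' t}].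
  case: (pickP [pred t | [&& t \in T, btw y t y' & E y' t]]) => [t0 h0|hn]; last first.
    exists (ord y'); split=> //.
      have -> : itv (ord y') (ord y') Y = set0 by apply/setP => z; rewrite !inE; lia.
      by rewrite chi0.
    move=> t tT h; apply/negP => Et; have := hn t; rewrite /= tT Et andbT /between.
    by move: h; lia.
  case: (arg_minnP ord h0) => t /and3P[tT yty' yt] tmin.
  exists (ord t); split.
  - by move: yty' lyy'; rewrite /between; lia.
  - by move: yty' lyy'; rewrite /between; lia.
  - rewrite -[leqRHS]addn1; apply: leq_trans _ (leq_add (hSh _ _ y'S tT yt) (chi1 adjxx t)).
    apply: chi_le2; apply/subsetP => z; rewrite !inE => /andP[-> h] /=.
    by rewrite -(inj_eq ord_inj) /between; move: h; clear; lia.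
  - move=> s sT h; apply/negP => Es; have := tmin s; rewrite /= sT Es andbT.
    by rewrite /between; move: h yty'; rewrite /between; clear; lia.
have hm : chi (itv p q Y) <= 2 * xi.
  apply: chi_gap => t tT; apply/negP => h.
  have yP : y \in P by apply: (subsetP YP); apply: (subsetP ShY).
  have y'P : y' \in P by apply: (subsetP YP); apply: (subsetP ShY).
  have h1 : ~~ E y t by apply: noT1 => //; move: h qy'; clear; lia.
  have h2 : ~~ E y' t by apply: noT2 => //; move: h yp; clear; lia.
  have := E1 y y' t yP y'P tT yy'; rewrite (negbTE h1) (negbTE h2) /between => hf.
  by suff : false by []; apply: hf; move: h yp qy'; clear; lia.
have h3 : chi (bset Y y y') <= chi (itv (ord y).+1 p Y :|: itv p q Y) + chi (itv q (ord y') Y).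
  apply: chi_le2; apply/subsetP => z; rewrite !inE => /andP[-> h] /=.
  by move: h lyy'; rewrite /between; lia.
have := chiU adjxx (itv (ord y).+1 p Y) (itv p q Y); move: h3 hm hp hq; lia.
Qed.

(** The stretch from [y] to [t2] is cut into a piece of prescribed chromatic number, a piece of
    [2 * xi + 1], which contains a ray [t] by [chi_gap], and a rest. Then [y] meets [t] by the third
    clause of [ray_rel]. The value of [short_bound] leaves more than [beta] next to [y] and more
    than [(beta.*2).+1] next to [t2]. *)
Lemma deep_witness y : y \in Y ->
  (exists t2, [/\ t2 \in T, E y t2 & short_bound xi beta < chi (bset Y y t2)]) ->
  exists t t2, [/\ t \in T, t2 \in T, E y t & E y t2] /\
    [/\ btw y t t2, beta < chi (bset P y t) & (beta.*2).+1 < chi (bset P t t2)].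
Proof.
move=> yY [t2 [t2T yt2 hM]]; have [E4 E1 E2] := rE.
have yP : y \in P by apply: (subsetP YP).
have ray_in p e : chi (itv p e Y) = (2 * xi).+1 -> exists2 t, t \in T & p <= ord t < e.
  move=> he; apply: contrapT => h.
  have : chi (itv p e Y) <= 2 * xi; last by rewrite he ltnn.
  by apply: chi_gap => t tT; apply/negP => h'; apply: h; exists t.
have split3 lo hi n : lo <= hi -> n + (2 * xi).+1 <= chi (itv lo hi Y) -> exists e1 e2 t,
    [/\ t \in T, e1 <= ord t < e2, lo <= e1 & e2 <= hi] /\
    [/\ chi (itv lo e1 Y) = n & chi (itv lo hi Y) <= n + (2 * xi).+1 + chi (itv e2 hi Y)].
  move=> lohi hn.
  have [|e1 /andP[l1 l2] h1] := @chi_prefix _ _ adjxx _ ord_inj lo hi n Y lohi; first by lia.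
  have h2 : chi (itv lo hi Y) <= chi (itv lo e1 Y) + chi (itv e1 hi Y).
    by apply: chi_le2; apply/subsetP => z; rewrite !inE => /andP[-> h] /=; move: h; lia.
  have [|e2 /andP[l3 l4] h3] := @chi_prefix _ _ adjxx _ ord_inj e1 hi (2 * xi).+1 Y l2; first by lia.
  have h4 : chi (itv e1 hi Y) <= chi (itv e1 e2 Y) + chi (itv e2 hi Y).
    by apply: chi_le2; apply/subsetP => z; rewrite !inE => /andP[-> h] /=; move: h; lia.
  have [t tT ht] := ray_in _ _ h3.
  by exists e1, e2, t; split; split=> //; move: h2 h4; rewrite h1 h3; lia.
have toP (p q : nat) x z : (forall u, p <= ord u < q -> btw x u z) ->
    chi (itv p q Y) <= chi (bset P x z).
  move=> h; apply/chiS/subsetP => u; rewrite !inE => /andP[uY hu].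
  by rewrite (subsetP YP) //= h.
have MV : short_bound xi beta = 3 * beta + 2 * xi + 5 by [].
case: (ltngtP (ord y) (ord t2)) => [l|l|/ord_inj E0]; last first.
- move: hM; rewrite E0; have -> : bset Y t2 t2 = set0 by apply/setP => z; rewrite !inE /between; clear; lia.
  by rewrite chi0.
- have Eb : bset Y y t2 = itv (ord t2).+1 (ord y) Y.
    by apply/setP => z; rewrite !inE /between; move: l; lia.
  have [||e1 [e2 [t [[tT het l1 l2] [h1 h2]]]]] := split3 (ord t2).+1 (ord y) (beta.*2).+2 => //.
    by move: hM; rewrite Eb MV; lia.
  have ytt2 : btw y t t2 by rewrite /between; move: het l1 l2; lia.
  exists t, t2; split; split=> //; first by apply: E2 yt2 ytt2.
    apply: (@leq_trans (chi (itv e2 (ord y) Y))); first by move: hM h2; rewrite Eb MV; lia.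
    by apply: toP => u; rewrite /between; move: het; lia.
  apply: (@leq_trans (chi (itv (ord t2).+1 e1 Y))); first by rewrite h1.
  by apply: toP => u; rewrite /between; move: het; lia.
have Eb : bset Y y t2 = itv (ord y).+1 (ord t2) Y.
  by apply/setP => z; rewrite !inE /between; move: l; lia.
have [||e1 [e2 [t [[tT het l1 l2] [h1 h2]]]]] := split3 (ord y).+1 (ord t2) beta.+1 => //.
  by move: hM; rewrite Eb MV; lia.
have ytt2 : btw y t t2 by rewrite /between; move: het l1 l2; lia.
exists t, t2; split; split=> //; first by apply: E2 yt2 ytt2.
  apply: (@leq_trans (chi (itv (ord y).+1 e1 Y))); first by rewrite h1.
  by apply: toP => u; rewrite /between; move: het; lia.
apply: (@leq_trans (chi (itv e2 (ord t2) Y))); first by move: hM h2; rewrite Eb MV; lia.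
by apply: toP => u; rewrite /between; move: het; lia.
Qed.

End Gap.

(** In the ray case, a ray is classified against each earlier level by whether it meets a long ray
    to its right, else one to its left, else none. Pigeonhole on the chosen ray [sg z] makes this
    pattern constant on [T']. Deleting the set [Sh] of vertices with short rays only makes the level
    deep. *)
Lemma next_level (L : nat -> lev V) (n c : nat) (X0 : {set V}) :
  step_bound xi beta n c < chi X0 -> exists (a : lev V) (cs : nat -> nat),
  [/\ c < chi (LX a), LP a \subset X0, LT a \subset X0, LX a \subset LP a &
    forall b, b < n -> cs b < 5 /\ level_rel (cs b) a (L b)].
Proof.
rewrite /step_bound; set M := short_bound xi beta; set c2 := c + _; set c1 := 3 ^ n * c2.
have cc2 : c <= c2 by rewrite leq_addr.
have cc1 : c <= c1 by rewrite /c1; apply: leq_trans cc2 _; rewrite leq_pmull ?expn_gt0.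
move=> /(level adjC ord_inj esc ray nbr)[P [T [PX TX hP kind]]].
have hPc : c < chi P by apply: leq_ltn_trans hP.
case: kind => [[E rE hE]|[sg ho hr]|[sg ho hr]]; first last.
- exists (Lev P P T (fun _ _ => false) sg), (fun _ => 4); split=> // b _; split=> //.
  split; first exact: out_rel_rev.
  move=> x y xP yP /=; rewrite /mirror.
  have := hr _ _ xP yP; have := ord_top ord (sg x); have := ord_top ord y.
  by move: (ord y) (ord (sg x)) (top ord) => u w z; clear; lia.
- by exists (Lev P P T (fun _ _ => false) sg), (fun _ => 3).
have /choice[sg hsg] : forall x, exists t, x \in P -> (t \in T) && E x t.
  move=> x; case: (boolP (x \in P)) => [xP|]; last by exists x.
  by have [t h1 h2] := hE _ xP; exists t; rewrite h1.
pose longR t (b : lev V) := exists s,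
  [/\ s \in LT b, LE b t s, ord t < ord s & beta < chi (bset P t s)].
pose longL t (b : lev V) := exists s,
  [/\ s \in LT b, LE b t s, ord s < ord t & beta < chi (bset P t s)].
pose pat t : {ffun 'I_n -> 'I_3} := [ffun i : 'I_n =>
  if `[< longR t (L i) >] then inord 1 else if `[< longL t (L i) >] then inord 2 else inord 0].
have [|phi hphi] := @chi_pigeon _ _ adjxx _ P (fun z => pat (sg z)) c2.
  by rewrite card_ffun !card_ord.
set Y := [set z in P | _] in hphi.
pose T' := [set t in T | pat t == phi].
have YP : Y \subset P by apply/subsetP => z; rewrite inE => /andP[].
have rE' : ray_rel adj ord P T' E.
  have [E4 E1 E2] := rE; have TT t : t \in T' -> t \in T by rewrite inE => /andP[].
  split; [by move=> x t xP /TT; apply: E4 | by move=> y w t yP wP /TT; apply: E1 |].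
  by move=> y s t yP /TT sT /TT; apply: E2.
have hsg' : {in Y, forall z, (sg z \in T') && E z (sg z)}.
  move=> z; rewrite inE => /andP[zP hz]; have /andP[h1 ->] := hsg _ zP.
  by rewrite inE h1 hz.
pose Sh := [set y in Y | `[< {in T', forall t, E y t -> chi (bset Y y t) <= M} >]].
have ShY : Sh \subset Y by apply/subsetP => z; rewrite inE => /andP[].
have hSh : chi Sh <= (2 * M.+1 + 2 * xi).+1.*2.
  apply: (chi_shorts rE' YP hsg' ShY) => y t; rewrite inE => /andP[_ /asboolP h] tT.
  exact: h.
have XYsub : Y :\: Sh \subset Y by apply: subsetDl.
exists (Lev P (Y :\: Sh) T' E id), (fun b => if insub b is Some i then val (phi i) else 0).
have raya : ray_level adjxx xi ord (Lev P (Y :\: Sh) T' E id).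
  split=> //=; first exact: subset_trans XYsub YP.
  move=> p q h; apply: leq_trans (chi_gap rE' YP hsg' h).
  by apply/chiS/subsetP => z; rewrite !inE => /andP[/andP[_ ->] ->].
split=> //=.
- have : chi Y <= chi Sh + chi (Y :\: Sh).
    by apply: chi_le2; apply/subsetP => x xX; rewrite in_setU in_setD xX andbT orbN.
  by move: hphi hSh; rewrite /c2; lia.
- by apply: subset_trans TX; apply/subsetP => t; rewrite inE => /andP[].
- exact: subset_trans XYsub YP.
move=> b bn; pose i : 'I_n := Ordinal bn.
have -> : insub b = Some i by rewrite insubT; congr Some; apply: val_inj.
split; first exact: leq_trans (ltn_ord _) _.
have patT t : t \in T' -> val (pat t i) = val (phi i) by rewrite inE => /andP[_ /eqP->].
have patv t : (val (pat t i) = 0 /\ ~ longR t (L b) /\ ~ longL t (L b)) \/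
    (val (pat t i) = 1 /\ longR t (L b)) \/ (val (pat t i) = 2 /\ longL t (L b)).
  rewrite ffunE /=; case: asboolP => hR; first by right; left; rewrite inordK.
  by case: asboolP => hL; [right; right | left]; rewrite inordK.
case E0 : (val (phi i)) (ltn_ord (phi i)) => [|[|[|]]] // _ /=.
- split=> //.
    move=> y /=; rewrite inE => /andP[yS yY]; apply: (deep_witness rE' YP hsg' yY).
    apply: contrapT => h; move/negP: yS; apply; rewrite inE yY /=; apply/asboolP => t tT yt.
    by rewrite leqNgt; apply/negP => h'; apply: h; exists t.
  move=> t s /= tT sT ts; rewrite leqNgt; apply/negP => h.
  have := patT _ tT; rewrite E0 => Ep.
  case: (patv t) => [[_ [nR nL]]|[[]|[]]]; rewrite ?Ep //.
  case: (ltngtP (ord t) (ord s)) => [l|l|/ord_inj E1]; [by apply: nR; exists s|by apply: nL; exists s|].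
  move: h; rewrite E1; have -> : bset P s s = set0 by apply/setP => z; rewrite !inE /between; clear; lia.
  by rewrite chi0.
- split=> // t /= tT; have := patT _ tT; rewrite E0 => Ep.
  by case: (patv t) => [[]|[[]|[]]]; rewrite ?Ep.
split=> // t /= tT; have := patT _ tT; rewrite E0 => Ep.
case: (patv t) => [[]|[[]|[]]]; rewrite ?Ep // => _ [s [h1 h2 h3 h4]].
exists s; split=> //; last by rewrite bset_rev.
rewrite /mirror; move: h3; have := ord_top ord t; have := ord_top ord s.
by move: (ord s) (ord t) (top ord) => u w z; clear; lia.
Qed.

(** The new level gets index [n], lies inside all earlier ones, and brings its row of codes against
    them. *)
Lemma tower (n c : nat) (X0 : {set V}) : tower_bound xi beta n c < chi X0 ->
  exists (L : nat -> lev V) (col : nat -> nat -> nat) (X : {set V}),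
  [/\ c < chi X, forall b, b < n -> X \subset LX (L b) &
   forall a b, b < a < n -> [/\ nest (L a) (L b), col a b < 5 & level_rel (col a b) (L a) (L b)]].
Proof.
elim: n c => [|n IH] c /=.
  move=> h; exists (fun _ => Lev set0 set0 set0 (fun _ _ => false) id), (fun _ _ => 0), X0.
  by split=> // a b; rewrite ltn0 andbF.
move=> /IH[L [col [X [hX XL hL]]]].
have [a [cs [ha aP aT aX hcs]]] := next_level L hX.
exists (fun i => if i == n then a else L i), (fun i => if i == n then cs else col i), (LX a).
have sX b : b < n -> X \subset LX (L b) by apply: XL.
split=> // [b|i b /andP[bi]].
  rewrite ltnS leq_eqVlt => /orP[/eqP->|bn]; first by rewrite eqxx.
  by rewrite ltn_eqF //; apply: subset_trans (subset_trans aX aP) (sX _ bn).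
rewrite ltnS leq_eqVlt => /orP[/eqP E|iln].
  have bn : b < n by rewrite -E.
  rewrite E eqxx ltn_eqF //; have [h1 h2] := hcs _ bn; split=> //.
  by rewrite /nest (subset_trans aP (sX _ bn)) (subset_trans aT (sX _ bn)).
have bn := ltn_trans bi iln.
by rewrite !ltn_eqF //; apply: hL; rewrite bi.
Qed.

End Step.

(** * Contradiction from a long homogeneous tower *)

Lemma pairs_map (T : Type) (R : T -> T -> Prop) (L : nat -> T) (r : rel nat) (s : seq nat) :
  pairwise r s -> {in s &, forall x y, r x y -> R (L x) (L y)} -> pairs R (map L s).
Proof.
elim: s => [|x s IH] //= /andP[xs ps] h; split; last first.
  by apply: IH => // u w us ws; apply: h; rewrite inE ?us ?ws orbT.
have {}h y : y \in s -> R (L x) (L y).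
  by move=> ys; apply: h; rewrite ?inE ?eqxx ?ys ?orbT //; move/allP: xs; apply.
elim: s h {IH xs ps} => [|y s IH] //= h b [<-|]; first by apply: h; rewrite inE eqxx.
by apply: IH => u us; apply: h; rewrite inE us orbT.
Qed.

Lemma alls_map (T : Type) (R : T -> Prop) (L : nat -> T) (s : seq nat) :
  {in s, forall x, R (L x)} -> alls R (map L s).
Proof.
elim: s => [|x s IH] h b //= [<-|]; first by apply: h; rewrite inE eqxx.
by apply: IH => u us; apply: h; rewrite inE us orbT.
Qed.

Section Final.
Variables (V : finType) (adj : rel V).
Hypotheses (adjC : symmetric adj) (adjxx : irreflexive adj).
Variable ord : V -> nat.
Hypothesis ord_inj : injective ord.
Local Notation chi := (chi adjxx).
Hypothesis esc : escape_property adj ord.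
Hypothesis ray : ray_property adj ord.
Variables k xi N : nat.
Hypothesis nbr : forall v, chi [set x | adj v x] <= xi.
Hypothesis noclique : forall K, is_clique adj K -> #|K| <= k.
Hypothesis bigclique : forall S : {set V}, xi < chi S ->
  exists K : {set V}, [/\ K \subset S, is_clique adj K & #|K| = k].

(** Room for [k.+1] rounds of [long_levels]. *)
Let beta := k.+1 * (2 * xi).+1.
Hypothesis hN : forall (col : nat -> nat -> 'I_5), exists s c,
  [/\ subseq s (rev (iota 0 N)), size s = (k.+1 + out_length k k).+1 &
      pairwise (fun x y => col x y == c) s].

Lemma is_clique0 : is_clique adj set0.
Proof. by move=> x y; rewrite inE. Qed.

Lemma bounded_chi : chi setT <= tower_bound xi beta N (out_bound k xi k + beta).
Proof.
rewrite leqNgt; apply/negP => /(tower adjC ord_inj esc ray nbr)[L [col [X [hX XL hL]]]].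
have [s [c [ss sz ps]]] := hN (fun a b => inord (col a b)).
have sN x : x \in s -> x < N by move/(mem_subseq ss); rewrite mem_rev mem_iota => /andP[].
have dec : pairwise (fun x y => y < x) s.
  apply: subseq_pairwise ss _; rewrite -sorted_pairwise; last by move=> a b d; lia.
  by rewrite rev_sorted; apply: iota_ltn_sorted.
(* The outermost level [y] is set aside as a common partner: [level_rel] against it yields the
   properties of each other single level. *)
case/lastP: s ss sz ps sN dec => [|s y] // ss; rewrite size_rcons => -[sz] ps sN dec.
have ys : y \in rcons s y by rewrite mem_rcons inE eqxx.
have sub_s x : x \in s -> x \in rcons s y by rewrite mem_rcons inE => ->; rewrite orbT.
have rec x z : x \in rcons s y -> z \in rcons s y -> (z < x) && (inord (col x z) == c) ->
    nest (L x) (L z) /\ level_rel adjxx ord xi beta (val c) (L x) (L z).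
  move=> xs zs /andP[zx /eqP <-]; have [|h1 h2 h3] := hL x z; first by rewrite zx sN.
  by rewrite /= inordK.
have prs : pairwise (fun x z => (z < x) && (inord (col x z) == c)) (rcons s y).
  by rewrite pairwise_relI dec ps.
have lst x : x \in s -> level_rel adjxx ord xi beta (val c) (L x) (L y).
  move=> xs; have [] := rec x y (sub_s _ xs) ys _ => //.
  by move: prs; rewrite pairwise_rcons => /andP[/allP h _]; apply: h.
have prs1 q : pairwise (fun x z => (z < x) && (inord (col x z) == c)) (take q s).
  apply: subseq_pairwise prs; apply: subseq_trans (take_subseq s q) _.
  by rewrite -cats1; apply: prefix_subseq.
have ts q x : x \in take q s -> x \in s by apply: mem_take.
have nestq q : pairs (fun a b => nest a b) (map L (take q s)).
  by apply: (pairs_map (prs1 q)) => x z /ts xs /ts zs h; have [] := rec x z (sub_s _ xs) (sub_s _ zs) h.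
have relq q : pairs (level_rel adjxx ord xi beta (val c)) (map L (take q s)).
  by apply: (pairs_map (prs1 q)) => x z /ts xs /ts zs h; have [] := rec x z (sub_s _ xs) (sub_s _ zs) h.
have pairsW (R R' : lev V -> lev V -> Prop) (l : seq (lev V)) :
    (forall a b, R a b -> R' a b) -> pairs R l -> pairs R' l.
  move=> RR; elim: l => [|a l IH] //= [h1 h2]; split; last exact: IH.
  by move=> b bl; apply/RR/h1.
have XLq q : alls (fun b => X \subset LX b) (map L (take q s)).
  by apply: alls_map => x /ts xs; apply/XL/sN/sub_s.
have szq q : q <= size s -> size (map L (take q s)) = q by move=> h; rewrite size_map size_takel.
have kc : k <= size s by rewrite sz; lia.
have k1c : k.+1 <= size s by rewrite sz; lia.
have oc : out_length k k <= size s by rewrite sz; lia.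
have absurd_cl K : is_clique adj K -> #|K| = k.+1 -> False.
  by move=> /noclique h E; move: h; rewrite E ltnn.
have allk : forall q x, x \in take q s -> level_rel adjxx ord xi beta (val c) (L x) (L y).
  by move=> q x /ts; apply: lst.
have outcase (o : V -> nat) : injective o -> {in s, forall x, right_level adj o (L x)} -> False.
  move=> oi hr.
  apply: (@out_levels _ adj adjC adjxx k xi nbr noclique bigclique o oi k
           (map L (take (out_length k k) s)) set0 X).
  - exact: is_clique0.
  - by rewrite cards0.
  - exact: szq.
  - exact: nestq.
  - by apply: alls_map => x /ts; apply: hr.
  - exact: XLq.
  - by move=> b _ q z; rewrite inE.
  - by apply: leq_ltn_trans hX; apply: leq_addr.
have longcase (o : V -> nat) : injective o ->
    {in s, forall x, ray_level adjxx xi o (L x)} ->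
    (forall q, pairs (long_pair adjxx beta o) (map L (take q s))) -> False.
  move=> oi hr hl.
  have Et : itv o 0 (top o) X = X by apply/setP => z; rewrite inE leq0n ord_top !andbT.
  have [||||||K [cK sK]] := @long_levels _ adj adjC adjxx xi beta o oi
      (map L (take k.+1 s)) X set0 0 (top o) is_clique0 (nestq _) (hl _) _ (XLq _).
  - by apply: alls_map => x /ts; apply: hr.
  - by move=> b _; apply: sub0set.
  - by move=> b _ u t; rewrite inE.
  - by rewrite szq // Et; apply: ltnW; apply: leq_ltn_trans hX; apply: leq_addl.
  - by [].
  - by rewrite szq.
  by apply: (absurd_cl K) => //; rewrite sK cards0 szq.
case: c {ps} relq allk lst rec prs prs1 => [[|[|[|[|c]]]] hc] /= relq allk lst rec prs prs1.
(* Here [k] short levels give a clique of [k] rays met by [y0], and [y0] itself completes it to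
   [k.+1]. *)
- have [y0 y0X] : exists x, x \in X by apply: (@chi_gt0 _ _ adjxx); apply: leq_ltn_trans hX.
  have rayq : alls (ray_level adjxx xi ord) (map L (take k s)).
    by apply: alls_map => x /allk[].
  have y0L : alls (fun b => y0 \in LX b) (map L (take k s)).
    by move=> b bL; apply: (subsetP (XLq k b bL)).
  have [||U [cU sU hU]] := @short_levels _ adj adjC adjxx xi beta ord ord_inj
      (map L (take k s)) y0 (nestq _) _ rayq _ y0L.
  + by apply: pairsW (relq k) => a b [].
  + by apply: alls_map => x /allk[].
  have y0U : {in U, forall u, adj y0 u}.
    move=> u /hU[b [bL uT yu]]; have [[E4 _ _] XP _] := rayq _ bL.
    by apply: E4 => //; apply: (subsetP XP); apply: y0L.
  have [c1 c2] := is_cliqueU1 adjC adjxx cU y0U.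
  by apply: (absurd_cl _ c1); rewrite c2 sU szq.
- apply: (longcase ord) => // [x /lst[]//|q].
  by apply: pairsW (relq q) => a b [].
- apply: (longcase (mirror ord)) => // [|x /lst[h _]|q]; first exact: mirror_inj.
    exact: ray_level_rev.
  by apply: pairsW (relq q) => a b [].
- by apply: (outcase ord).
- by apply: (outcase (mirror ord)) => //; apply: mirror_inj.
Qed.

End Final.

(* Vertices outside [S] are kept, as isolated vertices. *)
Section Induced.
Variables (V : finType) (adj : rel V) (adjC : symmetric adj) (adjxx : irreflexive adj).
Variables (ord : V -> nat) (S : {set V}).

Definition induced : rel V := [rel x y | [&& x \in S, y \in S & adj x y]].

Lemma inducedC : symmetric induced.
Proof. by move=> x y; rewrite /induced /= adjC andbCA. Qed.

Lemma inducedxx : irreflexive induced.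
Proof. by move=> x; rewrite /induced /= adjxx !andbF. Qed.

Lemma chi_induced : chi adjxx S <= chi inducedxx setT.
Proof.
apply/chiP; have [c [c1 c2]] := ncol_chi inducedxx setT; exists c; split=> [x _|x y xS yS xy].
  by apply: c1; rewrite inE.
by apply: c2; rewrite ?inE // /induced /= xS yS.
Qed.

Lemma is_clique_induced K : is_clique induced K -> is_clique adj K /\ (1 < #|K| -> K \subset S).
Proof.
move=> cK; split=> [x y xK yK xy|/card_gt1P[x [y [xK yK xy]]]].
  by case/and3P: (cK _ _ xK yK xy).
apply/subsetP => z zK; case: (eqVneq z x) => [->|zx].
  by case/and3P: (cK _ _ xK yK xy).
by case/and3P: (cK _ _ zK xK zx).
Qed.

Lemma escape_induced : escape_property adj ord -> escape_property induced ord.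
Proof.
move=> esc p p' x s /and3P[pS p'S pp'] hx ps out.
have pa : path adj x s by apply: sub_path ps => u w /and3P[].
have [u us hu] := esc _ _ _ _ pp' hx pa out.
(* The walk ends outside the interval that contains [x], so it has an edge, and each of its vertices
   is on one. *)
have sS : {subset x :: s <= S}.
  case: s ps out {pa us} => [|z s] ps out; first by move: out hx; rewrite /=; lia.
  have : all (mem S) (x :: z :: s); last by move/allP.
  elim: s x z ps {hx out hu} => [|w s IH] x z /= => [/andP[/and3P[-> -> _] _]//|/andP[/and3P[-> zS _] h]].
  exact: IH.
exists u => //; have uS := sS _ us.
by rewrite /induced /= uS pS p'S /=.
Qed.

(** The property is applied to [X :&: S], and [E] is made false off [S] and off the rays inner for
    that set. A ray between two vertices of [X :&: S], or between [y] and such an inner ray, is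
    inner for it again. *)
Lemma ray_induced : ray_property adj ord -> ray_property induced ord.
Proof.
move=> ray v T X vT Tind vX vs.
(* For empty [T] nothing places [v] in [S]. *)
case: (set_0Vmem T) => [T0|[t0 t0T]].
  have I0 t : t \in inner ord T X = false by rewrite T0 !inE.
  by exists (fun _ _ => false); split=> // y w t _ _; rewrite I0.
have vS : v \in S by case/and3P: (vT _ t0T).
have TS t : t \in T -> t \in S by move/vT/and3P=> [].
have [||||E [E4 E1 E2]] := ray v T (X :&: S).
- by move=> t /vT/and3P[].
- move=> s t sT tT; by have := Tind _ _ sT tT; rewrite /induced /= !TS.
- by move=> x /setIP[xX xS]; have := vX _ xX; rewrite /induced /= vS xS.
- by case: vs => h; [left|right] => x /setIP[xX _]; apply: h.
have inW t : t \in inner ord T (X :&: S) -> t \in inner ord T X.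
  rewrite !inE => /andP[-> /existsP[x /andP[/setIP[xX _] /existsP[y /andP[/setIP[yX _] h]]]]] /=.
  by apply/existsP; exists x; rewrite xX /=; apply/existsP; exists y; rewrite yX.
have inI x y t : x \in X :&: S -> y \in X :&: S -> t \in T -> ord x < ord t < ord y ->
    t \in inner ord T (X :&: S).
  move=> xX yX tT h; rewrite inE tT /=.
  by apply/existsP; exists x; rewrite xX /=; apply/existsP; exists y; rewrite yX.
have inT t : t \in inner ord T X -> t \in T by rewrite inE => /andP[].
exists (fun y t => [&& y \in S, t \in inner ord T (X :&: S) & E y t]); split.
- move=> y t yX tT /and3P[yS tI yt]; rewrite /induced /= yS TS ?inT //=.
  by apply: E4 => //; rewrite inE yX.
- move=> y w t yX wX tT /and3P[yS wS yw] h.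
  have yI : y \in X :&: S by rewrite inE yX.
  have wI : w \in X :&: S by rewrite inE wX.
  have tI : t \in inner ord T (X :&: S).
    by case/orP: (h) => h'; [apply: (inI y w) | apply: (inI w y)] => //; apply: inT.
  by rewrite yS wS tI /=; apply: E1.
move=> y s t yX sT tT /and3P[yS sI ys] h.
have yI : y \in X :&: S by rewrite inE yX.
have tI : t \in inner ord T (X :&: S).
  move: (sI); rewrite inE => /andP[_ /existsP[a /andP[aI /existsP[b /andP[bI sab]]]]].
  by case/orP: (h) => h'; [apply: (inI y b) | apply: (inI a y)] => //; try exact: inT;
     move: h' sab; clear; lia.
by rewrite yS tI /=; apply: E2 ys h.
Qed.

End Induced.

(** Induction on the clique number. The bound [xi] for cliques of size at most [k.+1] holds for
    neighbourhoods, where adding the centre enlarges a clique, and for every set without a clique of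
    size [k.+2]. These are the hypotheses of [bounded_chi] with [k.+2] for its [k]. *)
Theorem ordered_chi_bounded (k : nat) : exists c, forall (V : finType) (adj : rel V)
  (adjC : symmetric adj) (adjxx : irreflexive adj) (ord : V -> nat),
  injective ord -> escape_property adj ord -> ray_property adj ord ->
  (forall K, is_clique adj K -> #|K| <= k.+1) -> chi adjxx setT <= c.
Proof.
elim: k => [|k [xi IH]].
  exists 1 => V adj adjC adjxx ord _ _ _ hK; apply/chiP; exists (fun _ => 0); split=> // x y _ _ xy.
  have : is_clique adj [set x; y].
    by move=> u w /set2P[]-> /set2P[]->; rewrite ?eqxx // adjC.
  move/hK; rewrite cards2; case: eqVneq => // E; by rewrite E adjxx in xy.
have [N hN] := ramsey 'I_5 (k.+3 + out_length k.+2 k.+2).+1.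
exists (tower_bound xi (k.+3 * (2 * xi).+1) N (out_bound k.+2 xi k.+2 + k.+3 * (2 * xi).+1)).
move=> V adj adjC adjxx ord oi esc ray hK.
have sub (S : {set V}) : (forall K : {set V}, K \subset S -> is_clique adj K -> #|K| <= k.+1) ->
    chi adjxx S <= xi.
  move=> hS; apply: leq_trans (chi_induced adjxx S) _.
  apply: (IH _ _ (inducedC adjC S) _ ord oi).
  - exact: escape_induced.
  - exact: ray_induced.
  move=> K /is_clique_induced[cK KS]; case: (leqP #|K| 1) => [h|/KS h]; last exact: hS.
  exact: leq_trans h _.
apply: (bounded_chi adjC (ord := ord)) => //.
- move=> v; apply: sub => K /subsetP Kv cK; rewrite -ltnS.
  have [|c1 <-] := @is_cliqueU1 _ adj adjC adjxx v K cK; last exact: hK.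
  by move=> x /Kv; rewrite inE.
- move=> S; apply: contraPP => hn; apply/negP; rewrite -leqNgt; apply: sub => K KS cK.
  have := hK _ cK; rewrite leq_eqVlt => /orP[/eqP E|//].
  by case: hn; exists K.
Qed.

From mathcomp Require Import all_order all_algebra.
From mathcomp Require Import all_classical all_reals all_analysis.
From mathcomp Require Import lra.

Import Order.TTheory GRing.Theory Num.Theory.
Import numFieldNormedType.Exports.
Import Defs.

Local Open Scope classical_set_scope.
Local Open Scope ring_scope.

(** * Crossing theorem in the half-plane *)

Section GridCrossing.
Variable R : realFieldType.

Definition close (e : R) (a b : R * R) : Prop :=
  [/\ - e < a.1 - b.1, a.1 - b.1 < e, - e < a.2 - b.2 & a.2 - b.2 < e].

Fixpoint parity (f : nat -> bool) (n : nat) : bool :=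
  if n is k.+1 then parity f k (+) f k else false.

Variables (e : R) (m l : nat) (p q : nat -> R * R).
Hypothesis stepp : forall i, (i < m)%N -> close e (p i) (p i.+1).
Hypothesis stepq : forall j, (j < l)%N -> close e (q j) (q j.+1).
Hypothesis p0 : forall i, (i <= m)%N -> 0 <= (p i).2.
Hypothesis q0 : forall j, (j <= l)%N -> 0 <= (q j).2.
Hypothesis far : forall i j, (i <= m)%N -> (j <= l)%N -> ~ close (2 * e) (p i) (q j).

Let s i j := (q j).2 < (p i).2.
Let xp i j := (q j).1 < (p i).1.
Let h j i := (s i j != s i.+1 j) && xp i j.
Let v i j := (s i j != s i j.+1) && xp i j.

Lemma far_axis i j : (i <= m)%N -> (j <= l)%N ->
  - (2 * e) < (p i).2 - (q j).2 < 2 * e ->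
  (p i).1 - (q j).1 <= - (2 * e) \/ 2 * e <= (p i).1 - (q j).1.
Proof.
move=> im jl /andP[h1 h2].
case: (leP ((p i).1 - (q j).1) (- (2 * e))) => h3; first by left.
case: (leP (2 * e) ((p i).1 - (q j).1)) => h4; first by right.
by case: (far im jl).
Qed.

(** If one pair of the cell differs in height by at least [2 * e], all four comparisons agree, since
    steps are below [e]. Otherwise [far] separates all pairs horizontally, so [xp] is constant on
    the cell, and the comparison changes an even number of times around it. *)
Lemma cell_even i j : (i < m)%N -> (j < l)%N ->
  h j.+1 i = h j i (+) v i j (+) v i.+1 j.
Proof.
move=> im jl; have [a1 a2 a3 a4] := stepp im; have [b1 b2 b3 b4] := stepq jl.
pose near i' j' := - (2 * e) < (p i').2 - (q j').2 < 2 * e.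
have same : (near i j && near i.+1 j) && (near i j.+1 && near i.+1 j.+1) \/
    [/\ s i j = s i.+1 j, s i j = s i j.+1 & s i j = s i.+1 j.+1].
  rewrite /near /s.
  case: (ltP (- (2 * e)) ((p i).2 - (q j).2)) => c1 /=; last by right; split; lra.
  case: (ltP ((p i).2 - (q j).2) (2 * e)) => c2 /=; last by right; split; lra.
  case: (ltP (- (2 * e)) ((p i.+1).2 - (q j).2)) => c3 /=; last by right; split; lra.
  case: (ltP ((p i.+1).2 - (q j).2) (2 * e)) => c4 /=; last by right; split; lra.
  case: (ltP (- (2 * e)) ((p i).2 - (q j.+1).2)) => c5 /=; last by right; split; lra.
  case: (ltP ((p i).2 - (q j.+1).2) (2 * e)) => c6 /=; last by right; split; lra.
  case: (ltP (- (2 * e)) ((p i.+1).2 - (q j.+1).2)) => c7 /=; last by right; split; lra.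
  by case: (ltP ((p i.+1).2 - (q j.+1).2) (2 * e)) => c8 /=; [left | right; split; lra].
rewrite /h /v; case: same => [/andP[/andP[n1 n2] /andP[n3 n4]]|[<- <- <-]]; last by rewrite !eqxx.
have f1 := far_axis (ltnW im) (ltnW jl) n1; have f2 := far_axis im (ltnW jl) n2.
have f3 := far_axis (ltnW im) jl n3.
have -> : xp i.+1 j = xp i j by rewrite /xp; case: f1; case: f2; lra.
have -> : xp i j.+1 = xp i j by rewrite /xp; case: f1; case: f3; lra.
by case: (xp i j); rewrite ?andbF // !andbT; case: (s i j); case: (s _ _); case: (s _ _); case: (s _ _).
Qed.

(** [cell_even] telescopes along the row. The end terms vanish: an end of [p] on the baseline is
    never above a [q j]. *)
Lemma row_shift j : (j < l)%N -> (p 0).2 = 0 -> (p m).2 = 0 ->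
  parity (h j.+1) m = parity (h j) m.
Proof.
move=> jl z0 zm.
have vf i : (i <= m)%N -> (p i).2 = 0 -> v i j = false.
  move=> im z; rewrite /v /s z !ltNge !q0 //; exact: ltnW.
suff H n : (n <= m)%N -> parity (h j.+1) n = parity (h j) n (+) v 0 j (+) v n j.
  by rewrite H // !vf // !addbF.
elim: n => [|n IH] nm; first by rewrite /= addbb.
rewrite /= IH ?(ltnW nm) // cell_even //.
by case: (parity _ _); case: (v 0%N j); case: (v n j); case: (h j n); case: (v n.+1 j).
Qed.

(** The invariant says that the parity is odd exactly when [p n] is on the baseline to the right of
    [q j]. A step with an end on the baseline cannot pass [q j], by [far]. *)
Lemma row_parity j : (j <= l)%N -> (q j).2 = 0 -> (p 0).1 < (q j).1 ->
  (p 0).2 = 0 -> (p m).2 = 0 -> parity (h j) m = xp m j.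
Proof.
move=> jl z lt0 z0 zm.
suff H n : (n <= m)%N -> parity (h j) n = ~~ s n j && xp n j.
  by rewrite H // /s zm z ltxx.
elim: n => [|n IH] nm.
  by rewrite /= /xp ltNge (ltW lt0) andbF.
have [a1 a2 a3 a4] := stepp nm; rewrite /= IH ?(ltnW nm) // /h.
have pn := p0 (ltnW nm); have pn1 := p0 nm.
have xpE : ~~ s n j || ~~ s n.+1 j -> xp n.+1 j = xp n j.
  rewrite /s z -!leNgt => o.
  have f1 : - (2 * e) < (p n).2 - (q j).2 < 2 * e by rewrite z; case/orP: o => o; lra.
  have f2 : - (2 * e) < (p n.+1).2 - (q j).2 < 2 * e by rewrite z; case/orP: o => o; lra.
  by rewrite /xp; case: (far_axis (ltnW nm) jl f1); case: (far_axis nm jl f2); lra.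
case: (s n j) xpE => [] /=; case: (s n.+1 j) => //= xpE; rewrite ?xpE //; by case: (xp n j).
Qed.

(** The row of [q 0], left of [p m], is odd, and that of [q l], right of [p m], is even; yet all
    rows agree. *)
Lemma grid_crossing : (p 0).2 = 0 -> (p m).2 = 0 -> (q 0).2 = 0 -> (q l).2 = 0 ->
  (p 0).1 < (q 0).1 -> (q 0).1 < (p m).1 -> (p m).1 < (q l).1 -> False.
Proof.
move=> zp zm zq zl l1 l2 l3.
have r0 : parity (h 0) m = true by rewrite row_parity.
have rl : parity (h l) m = false.
  by rewrite row_parity // /xp ?ltNge ?(ltW l3) //; lra.
suff : parity (h l) m = parity (h 0) m by rewrite r0 rl.
suff H n : (n <= l)%N -> parity (h n) m = parity (h 0) m by apply: H.
by elim: n => // n IH nl; rewrite row_shift // IH // ltnW.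
Qed.

End GridCrossing.

(** * From epsilon-chains to continua *)

Section Crossing.
Variable R : realType.
Implicit Types (A B : set (R * R)).

Lemma closeE (e : R) (a b : R * R) : close e a b <-> ball a e b.
Proof.
case: a b => a1 a2 [b1 b2]; rewrite /close /=; split.
  by move=> [h1 h2 h3 h4]; split; rewrite /ball /= ltr_norml; apply/andP; split; lra.
by move=> [] /=; rewrite /ball /= !ltr_norml => /andP[h1 h2] /andP[h3 h4]; split; lra.
Qed.

Lemma closeC (e : R) (a b : R * R) : close e a b -> close e b a.
Proof. by move=> [*]; split; lra. Qed.

(** The points of [A] reached by chains from [x] form a relatively open and closed subset. *)
Lemma connected_chain A (e : R) x y : 0 < e -> connected A -> A x -> A y ->
  exists n (f : nat -> R * R), [/\ f 0%N = x, f n = y,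
    forall i, (i <= n)%N -> A (f i) & forall i, (i < n)%N -> close e (f i) (f i.+1)].
Proof.
move=> e0 cA Ax Ay.
pose reach z := exists n (f : nat -> R * R), [/\ f 0%N = x, f n = z,
  forall i, (i <= n)%N -> A (f i) & forall i, (i < n)%N -> close e (f i) (f i.+1)].
suff /seteqP[_ H] : [set z | reach z] = A by exact: H.
have reachA z : reach z -> A z by move=> [n [f [_ <- h _]]]; apply: h.
have step z z' : reach z -> A z' -> close e z z' -> reach z'.
  move=> [n [f [f0 fn fA fs]]] Az' zz'.
  exists n.+1, (fun i => if (i <= n)%N then f i else z'); split => //.
  - by rewrite ltnn.
  - by move=> i _; case: ifP => // /fA.
  - move=> i; rewrite ltnS => ile; rewrite ile; case: ifP => [/fs //|].
    move/negbT; rewrite -ltnNge ltnS => ni; have -> : i = n by apply/eqP; rewrite eqn_leq ile ni.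
    by rewrite fn.
apply: cA.
- exists x, 0%N, (fun=> x); split => //.
- exists (\bigcup_(z in [set z | reach z]) ball z e).
    by apply: bigcup_open => z _; apply: ball_open.
  apply/seteqP; split=> [z rz|z [Az [w rw wz]]].
    by split; [exact: reachA | exists z => //; apply: ballxx].
  by apply: step rw Az _; apply/closeE.
- exists (~` \bigcup_(z in A `\` [set z | reach z]) ball z e).
    by apply: open_closedC; apply: bigcup_open => z _; apply: ball_open.
  apply/seteqP; split=> [z rz|z [Az nz]].
    split; first exact: reachA.
    by move=> [w [Aw nw] /closeE wz]; apply: nw; apply: step rz Aw _; apply: closeC.
  by apply: contrapT => nrz; apply: nz; exists z => //; apply: ballxx.
Qed.

(** If the ball of radius [d] at [a] misses [B], then [d / 2] separates the ball of half that radius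
    from [B]; compactness of [A] makes the choice uniform. *)
Lemma compact_separated A B : compact A -> compact B -> A `&` B = set0 ->
  exists2 e : R, 0 < e & forall a b, A a -> B b -> ~ close e a b.
Proof.
move=> cA cB AB.
have clB : closed B by apply: compact_closed => //; apply: norm_hausdorff.
move/compact_near_coveringP: cA => /(_ R (0^'+) (fun e a => forall b, B b -> ~ close e a b)) H.
have {H} : \forall e \near (0 : R)^'+, A `<=` (fun a => forall b, B b -> ~ close e a b).
  apply: H => a Aa.
  have : nbhs a (~` B).
    apply: open_nbhs_nbhs; split; first exact: closed_openC.
    by move=> Ba; have : (A `&` B) a by []; rewrite AB.
  rewrite -nbhs_ballE => -[d /= d0 dB].
  exists (ball a (d / 2), [set e : R | e < d / 2]) => /=.
    split; first by apply: nbhsx_ballx; lra.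
    by apply: nbhs_right_lt; lra.
  move=> [a' e] /= [/closeE [h1 h2 h3 h4] ed] b Bb [h5 h6 h7 h8].
  by apply: (dB b) => //; apply/closeE; split; lra.
move=> h.
have : \forall e \near (0 : R)^'+, 0 < e /\ A `<=` (fun a => forall b, B b -> ~ close e a b).
  by apply: filterS2 (nbhs_right_gt 0) h.
move=> /filter_ex [e [e0 eh]]; exists e => // a b Aa Bb; exact: eh.
Qed.

Lemma crossing A B (a1 a2 b1 b2 : R) :
  compact A -> connected A -> compact B -> connected B ->
  A `<=` [set p | 0 <= p.2] -> B `<=` [set p | 0 <= p.2] ->
  A (a1, 0) -> A (a2, 0) -> B (b1, 0) -> B (b2, 0) ->
  a1 < b1 < a2 -> a2 < b2 -> A `&` B !=set0.
Proof.
move=> kA cA kB cB hA hB A1 A2 B1 B2 /andP[ab1 ba] ab2.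
apply/set0P/negP => /eqP AB.
have [e e0 far] := compact_separated kA kB AB.
have e20 : 0 < e / 2 by lra.
have [m [p [p0 pm pA ps]]] := connected_chain e20 cA A1 A2.
have [l [q [q0 ql qB qs]]] := connected_chain e20 cB B1 B2.
have p2 i : (i <= m)%N -> 0 <= (p i).2 by move=> /pA /hA.
have q2 j : (j <= l)%N -> 0 <= (q j).2 by move=> /qB /hB.
have pq i j : (i <= m)%N -> (j <= l)%N -> ~ close (2 * (e / 2)) (p i) (q j).
  by move=> /pA Ai /qB Bj; rewrite mulrC divfK ?pnatr_eq0 //; apply: far.
by apply: (grid_crossing ps qs p2 q2 pq); rewrite ?p0 ?pm ?q0 ?ql.
Qed.

End Crossing.

(** * Grounded curves *)

Section Curves.
Variable R : realType.
Implicit Types (A B C K : set (R * R)).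

Definition planar_continuum A := [/\ compact A, connected A & A `<=` halfplane].

Lemma planar_continuumU A B : A `&` B !=set0 ->
  planar_continuum A -> planar_continuum B -> planar_continuum (A `|` B).
Proof.
move=> AB [kA cA hA] [kB cB hB]; split; first exact: compactU.
  exact: connectedU.
by rewrite subUset.
Qed.

(** The weak inequalities allow for curves with the same basepoint; equality yields a common point
    at once. *)
Lemma interleaved_meet A B (a1 a2 b1 b2 : R) :
  planar_continuum A -> planar_continuum B ->
  A (a1, 0) -> A (a2, 0) -> B (b1, 0) -> B (b2, 0) ->
  a1 <= b1 <= a2 -> (b2 <= a1) || (a2 <= b2) -> A `&` B !=set0.
Proof.
move=> [kA cA hA] [kB cB hB] A1 A2 B1 B2 /andP[ab ba].
move: ab; rewrite le_eqVlt => /predU1P[E|ab]; first by rewrite -E in B1; exists (a1, 0).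
move: ba; rewrite le_eqVlt => /predU1P[E|ba]; first by rewrite -E in A2; exists (b1, 0).
rewrite !le_eqVlt => /orP[/predU1P[E|lt]|/predU1P[E|lt]].
- by rewrite E in B2; exists (a1, 0).
- by rewrite setIC; apply: (crossing kB cB kA cA hB hA B2 B1 A1 A2); rewrite ?lt.
- by rewrite -E in B2; exists (a2, 0).
- by apply: (crossing kA cA kB cB hA hB A1 A2 B1 B2); rewrite ?ab.
Qed.

Lemma arc_continuum (a b c : R) (g : R -> R * R) :
  {within `[a, b], continuous g} -> g @` `[a, b] `<=` halfplane -> a <= c <= b ->
  planar_continuum (g @` `[a, c]).
Proof.
move=> cg hg /andP[ac cb].
have sub : `[a, c]%classic `<=` `[a, b]%classic.
  by move=> x /=; rewrite !in_itv /= => /andP[-> xc]; apply: le_trans xc cb.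
have cg' := continuous_subspaceW sub cg; split.
- by apply: continuous_compact cg' _; apply: segment_compact.
- by apply: connected_continuous_connected cg'; apply: segment_connected.
- by move=> _ [x xac <-]; apply: hg; exists x => //; apply: sub.
Qed.

Lemma within_continuous_opp (a b : R) (g : R -> R * R) :
  {within `[a, b], continuous g} -> {within `[- b, - a], continuous (g \o -%R)}.
Proof.
move=> /subspace_continuousP cg; apply/subspace_continuousP => x xab P nP.
have xab' : `[a, b]%classic (- x).
  by move: xab; rewrite /= !in_itv /= => /andP[]; rewrite lerNl lerNr => -> ->.
have := cg _ xab' P nP; rewrite /nbhs /= /within /= => -[e /= e0 he].
exists e => //= y xy yab; apply: (he (- y)).
  by move: xy; rewrite /= -opprD normrN.
by move: yab; rewrite /= !in_itv /= => /andP[]; rewrite lerNl lerNr => -> ->.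
Qed.

Lemma first_hit (a b : R) (g : R -> R * R) K :
  {within `[a, b], continuous g} -> closed K -> g @` `[a, b] `&` K !=set0 ->
  exists2 c, a <= c <= b & K (g c) /\ forall d, a <= d < c -> ~ K (g d).
Proof.
move=> /subspace_continuousP cg cK [_ [[d dab <-] Kd]].
pose H : set R := [set x | a <= x <= b /\ K (g x)].
have H0 : H !=set0 by exists d; split => //; move: dab; rewrite /= in_itv.
have lH : has_lbound H by exists a => x [/andP[]].
pose c := inf H.
have ac : a <= c by apply: lb_le_inf => // x [/andP[]].
have cH x : H x -> c <= x by move=> Hx; apply: ge_inf.
have cb : c <= b by case: H0 => x Hx; apply: le_trans (cH _ Hx) _; case: Hx => /andP[].
exists c; first by rewrite ac.
split=> [|x /andP[ax xc] Kx]; last first.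
  have : H x by split; rewrite // ax (le_trans (ltW xc) cb).
  by move=> /cH; rewrite leNgt xc.
apply: contrapT => nK.
have cab : `[a, b]%classic c by rewrite /= in_itv /= ac.
have : nbhs (g c) (~` K) by apply: open_nbhs_nbhs; split=> //; exact: closed_openC.
move=> /(cg _ cab); rewrite /nbhs /= /within /= => -[e /= e0 he].
have [x Hx xe] := inf_adherent e0 (conj H0 lH).
apply: (he x _ _ Hx.2); last by rewrite in_itv; exact: Hx.1.
rewrite /= ltr_norml; have := cH _ Hx; move: xe; rewrite -/c => xe cx.
by apply/andP; split; lra.
Qed.

(** [D] runs along [C] from the basepoint to the first point on [K]. A point of [D] off [K] is
    passed strictly earlier, so the arc up to it serves as [B]. *)
Lemma grounded_reach C K : grounded_curve C -> closed K -> C `&` K !=set0 ->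
  forall x, C (x, 0) -> exists D, [/\ planar_continuum D, D `<=` C, D (x, 0),
    D `&` K !=set0 & forall z, D z -> ~ K z -> exists B,
      [/\ planar_continuum B, B `<=` D, B (x, 0), B z & B `&` K = set0]].
Proof.
move=> [a [b [g [p [[ab cg ->] hC pE bC]]]]] cK CK x Cx.
have {bC Cx} xE : (x, 0) = p by have : ((g @` `[a, b]) `&` baseline) (x, 0) by []; rewrite bC.
(* If the basepoint is [g b], the parametrization is reversed. *)
wlog {pE xE} : a b g ab cg hC CK / (x, 0) = g a.
  move=> W; move: pE; rewrite -xE => -[|] pE; first exact: W.
  have E : g @` `[a, b] = (g \o -%R) @` `[- b, - a].
    apply/seteqP; split=> [_ [y yab <-]|_ [y yab <-]].
      exists (- y); rewrite /= ?opprK //.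
      by move: yab; rewrite /= !in_itv /= !lerN2 andbC.
    exists (- y); rewrite //=.
    by move: yab; rewrite /= !in_itv /= => /andP[]; rewrite lerNl lerNr => -> ->.
  move: hC CK; rewrite E => hC CK.
  apply: W => //; rewrite ?lerN2 ?opprK //.
  - exact: within_continuous_opp.
  - by rewrite /= opprK.
move=> xE; have [c /andP[ac cb] [Kc hc]] := first_hit cg cK CK.
have aac : `[a, c]%classic a by rewrite /= in_itv /= lexx.
exists (g @` `[a, c]); split.
- by apply: arc_continuum cg hC _; rewrite ac.
- move=> _ [y yac <-]; exists y => //; move: yac; rewrite /= !in_itv /= => /andP[-> yc].
  exact: le_trans yc cb.
- by exists a.
- by exists (g c); split => //; exists c => //=; rewrite in_itv /= ac lexx.
- move=> _ [y yac <-] nK.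
  move: yac; rewrite /= in_itv /= => /andP[ay]; rewrite le_eqVlt => /predU1P[E|yc].
    by rewrite E in nK.
  exists (g @` `[a, y]); split.
  + by apply: arc_continuum cg hC _; rewrite ay (le_trans (ltW yc) cb).
  + move=> _ [w way <-]; exists w => //; move: way; rewrite /= !in_itv /= => /andP[-> wy].
    exact: le_trans wy (ltW yc).
  + by exists a => //=; rewrite in_itv /= lexx.
  + by exists y => //=; rewrite in_itv /= ay lexx.
  + apply/seteqP; split=> // _ [[w way <-]]; apply: hc.
    by move: way; rewrite /= in_itv /= => /andP[-> wy]; apply: le_lt_trans wy yc.
Qed.

Lemma grounded_continuum C : grounded_curve C -> planar_continuum C.
Proof.
move=> [a [b [g [p [[ab cg E] hC _ _]]]]]; rewrite E; rewrite E in hC.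
by apply: arc_continuum cg hC _; rewrite ab /=.
Qed.

Lemma grounded_base C : grounded_curve C -> exists x, C (x, 0).
Proof.
move=> [_ [_ [_ [[x y] [_ _ _ bC]]]]].
have : [set (x, y)] (x, y) by []; rewrite -bC => -[Cxy]; rewrite /baseline /= => y0.
by exists x; rewrite -y0.
Qed.

End Curves.

(** * Escape and ray properties of grounded families *)

Section Outerstring.
Variables (R : realType) (I : finType) (F : I -> set (R * R)).
Hypothesis gF : grounded F.
Variable pos : I -> R.
Hypothesis Fpos : forall i, F i (pos i, 0).
Variable ord : I -> nat.
Hypothesis ord_pos : forall i j, (ord i < ord j)%N -> pos i <= pos j.

Local Notation btw := (between ord).

Let Fcont i : planar_continuum (F i) := grounded_continuum (gF i).

Lemma meets_touch i j : meets F i j -> F i `&` F j !=set0.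
Proof. by case/andP=> _ /asboolP. Qed.

Lemma not_meets i j : i != j -> ~~ meets F i j -> F i `&` F j = set0.
Proof.
by move=> ij; rewrite /meets ij /= => /asboolPn h; apply/eqP; apply: contrapT => /negP /set0P.
Qed.

Lemma btw_meet y t s v (A B : set (R * R)) :
  planar_continuum A -> planar_continuum B ->
  A (pos y, 0) -> A (pos s, 0) -> B (pos t, 0) -> B (pos v, 0) -> btw y t s ->
  (ord v < ord y /\ ord v < ord s)%N \/ (ord y < ord v /\ ord s < ord v)%N ->
  A `&` B !=set0.
Proof.
move=> cA cB Ay As Bt Bv b out; have {b} [] := orP b => /andP[/ord_pos h1 /ord_pos h2].
  apply: (interleaved_meet cA cB Ay As Bt Bv); rewrite ?h1 //.
  by case: out => -[/ord_pos h3 /ord_pos h4]; rewrite ?h3 ?h4 ?orbT.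
apply: (interleaved_meet cA cB As Ay Bt Bv); rewrite ?h1 //.
by case: out => -[/ord_pos h3 /ord_pos h4]; rewrite ?h3 ?h4 ?orbT.
Qed.

Lemma walk_continuum x s : path (meets F) x s ->
  planar_continuum (\bigcup_(u in [set u | u \in x :: s]) F u).
Proof.
elim: s x => [|y s IH] x /=.
  by move=> _; rewrite (_ : [set` [:: x]] = [set x]) ?bigcup_set1 //;
  apply/seteqP; split=> u /=; rewrite inE => /eqP.
move=> /andP[xy /IH ys].
have -> : \bigcup_(u in [set u | u \in [:: x, y & s]]) F u =
    F x `|` \bigcup_(u in [set u | u \in y :: s]) F u.
  apply/seteqP; split=> [z [u /= us Fu]|z [Fz|[u us Fu]]].
  - by move: us; rewrite inE => /predU1P[E|us]; [left; rewrite -E | right; exists u].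
  - by exists x => //=; rewrite inE eqxx.
  - by exists u => //=; rewrite inE [u \in _]us orbT.
apply: planar_continuumU => //; have [z [Fx Fy]] := meets_touch xy.
by exists z; split=> //; exists y => //=; rewrite inE eqxx.
Qed.

(** The union of [F p] and [F p'] and the union of the curves along the walk are continua with
    interleaved basepoints. *)
Lemma grounded_escape : escape_property (meets F) ord.
Proof.
move=> p p' x s pp' /andP[px xp'] xs out; apply: contrapT => no.
have dis u : u \in x :: s -> (F p `|` F p') `&` F u = set0.
  move=> us; have : ~~ [|| u == p, u == p', meets F u p | meets F u p'].
    by apply/negP => h; apply: no; exists u.
  rewrite !negb_or => /and4P[n1 n2 n3 n4].
  by rewrite setIUl setIC (not_meets n1 n3) set0U setIC (not_meets n2 n4).
have cA := planar_continuumU (meets_touch pp') (Fcont p) (Fcont p').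
have cB := walk_continuum xs.
have [|||||| z [Az [u us Fu]]] := @btw_meet p x p' (last x s) _ _ cA cB.
- by left.
- by right.
- by exists x => //=; rewrite inE eqxx.
- by exists (last x s) => //=; apply: mem_last.
- by rewrite /between px xp'.
- have pp := ltn_trans px xp'; case/orP: out => h; [left | right]; split=> //.
    exact: ltn_trans h pp.
  exact: ltn_trans pp h.
- by have : ((F p `|` F p') `&` F u) z by []; rewrite dis.
Qed.

(** The ray [D t] is continued by [F v], which is based outside the interval and avoids every curve
    of [X]. Crossed with the union of [F y] and [F w], this gives the second clause. For the third,
    [F y] is continued along [D s] by a piece [B] that avoids [F v], and avoids [F t] by
    independence, so only [F y] and [D t] can meet. *)
Lemma grounded_ray : ray_property (meets F) ord.
Proof.
move=> v T X vT indT vX sideX.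
have clv : closed (F v) by apply: compact_closed; [exact: norm_hausdorff | case: (Fcont v)].
have vX0 x : x \in X -> F v `&` F x = set0.
  by move=> /vX /andP[xv nvx]; apply: not_meets => //; rewrite eq_sym.
have /choice[D HD] : forall t, exists D, t \in T ->
   [/\ planar_continuum D, D `<=` F t, D (pos t, 0),
    D `&` F v !=set0 & forall z, D z -> ~ F v z -> exists B,
      [/\ planar_continuum B, B `<=` D, B (pos t, 0), B z & B `&` F v = set0]].
  move=> t; case: (boolP (t \in T)) => tT; last by exists set0.
  have tv : F t `&` F v !=set0 by rewrite setIC; apply: meets_touch; apply: vT.
  have [D hD] := grounded_reach (gF t) clv tv (Fpos t).
  by exists D.
exists (fun y t => `[< F y `&` D t !=set0 >]); split.
- move=> y t yX; rewrite inE => /andP[tT _] /asboolP[z [Fz Dz]].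
  rewrite /meets; apply/andP; split; last first.
    by apply/asboolP; exists z; split=> //; have [_ s _ _ _] := HD t tT; apply: s.
  by apply: contraTneq (vT t tT) => <-; case/andP: (vX y yX).
- move=> y w t yX wX; rewrite inE => /andP[tT _] yw ytw.
  have [cD DF Dt Dv _] := HD t tT.
  have cA := planar_continuumU (meets_touch yw) (Fcont y) (Fcont w).
  have cB := planar_continuumU Dv cD (Fcont v).
  have [|||||| z [[Fz|Fz] [Dz|Fvz]]] := @btw_meet y t w v _ _ cA cB => //.
  + by left.
  + by right.
  + by left.
  + by right.
  + by case: sideX => h; [left | right]; split; apply: h.
  + by apply/orP; left; apply/asboolP; exists z.
  + by have : (F v `&` F y) z by []; rewrite vX0.
  + by apply/orP; right; apply/asboolP; exists z.
  + by have : (F v `&` F w) z by []; rewrite vX0.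
- move=> y s t yX; rewrite inE => /andP[sT sX]; rewrite inE => /andP[tT _] /asboolP[z [yz sz]] yts.
  have [cD DF Dt Dv _] := HD t tT.
  have nvz : ~ F v z by move=> vz; have : (F v `&` F y) z by []; rewrite vX0.
  have [_ DsF _ _ /(_ z sz nvz) [B [cB BD Bs Bz Bv]]] := HD s sT.
  have cA : planar_continuum (F y `|` B) by apply: planar_continuumU => //; exists z.
  have cC := planar_continuumU Dv cD (Fcont v).
  have st : s != t by apply: contraTneq yts => ->; rewrite /between !ltnn /= andbF.
  have dis : F s `&` F t = set0 by apply: not_meets => //; apply: indT.
  have /exists_inP[x1 x1X /exists_inP[x2 x2X /andP[l1 l2]]] := sX.
  have [|||||| w [[Fz|Bw] [Dz|Fvz]]] := @btw_meet y t s v _ _ cA cC => //.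
  + by left.
  + by right.
  + by left.
  + by right.
  + case: sideX => h; [left | right]; split; try exact: h.
      exact: ltn_trans (h _ x1X) l1.
    exact: ltn_trans l2 (h _ x2X).
  + by apply/asboolP; exists w.
  + by have : (F v `&` F y) w by []; rewrite vX0.
  + have : (F s `&` F t) w by split; [apply: DsF; apply: BD | apply: DF].
    by rewrite dis.
  + by have : (B `&` F v) w by []; rewrite Bv.
Qed.

End Outerstring.

(** * Transfer to chromatic and clique numbers of intersection graphs *)

Lemma real_rank (R : realType) (I : finType) (pos : I -> R) :
  exists2 ord : I -> nat, injective ord & forall i j, (ord i < ord j)%N -> pos i <= pos j.
Proof.
pose le i j := pos i <= pos j; pose s := sort le (enum I).
have sI i : i \in s by rewrite mem_sort mem_enum.
have le_tr : transitive le by move=> j i k; apply: le_trans.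
have le_tot : total le by move=> i j; apply: le_total.
exists (fun i => index i s) => [i j|i j ij]; first exact: index_inj.
exact: (sorted_ltn_index le_tr (sort_sorted le_tot _)) ij.
Qed.

Lemma clique_numberP (G : sgraph) (k : nat) :
  (clique_number G <= k)%N -> forall K : {set G}, is_clique (@adj G) K -> (#|K| <= k)%N.
Proof.
move=> h K cK; apply: leq_trans h; apply: (leq_bigmax_cond (F := fun K : {set G} => #|K|)).
apply/forall_inP => x xK; apply/forall_inP => y yK; apply/implyP; exact: cK.
Qed.

Lemma chromatic_number_le (G : sgraph) (c : nat) :
  (chi (@adj_irrefl G) [set: G]%SET <= c)%N -> (chromatic_number G <= c)%N.
Proof.
move=> /chiP [f [fc fadj]]; rewrite /chromatic_number; case: ex_minnP => m _; apply.
have fc' x : (f x < c)%N by apply: fc; rewrite finset.in_setT.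
apply/existsP; exists [ffun x => Ordinal (fc' x)].
apply/forallP => x; apply/forallP => y; apply/implyP => xy; rewrite !ffunE.
by apply/eqP => -[]; apply: fadj; rewrite ?finset.in_setT.
Qed.

Lemma grounded_bounded (R : realType) (k : nat) : exists c : nat,
  forall (I : finType) (F : I -> set (R * R)), grounded F ->
  (clique_number (intersection_graph F) <= k.+1)%N ->
  (chromatic_number (intersection_graph F) <= c)%N.
Proof.
have [c hc] := ordered_chi_bounded k; exists c => I F gF wF.
have /choice[pos Fpos] : forall i, exists x, F i (x, 0) by move=> i; apply: grounded_base.
have [ord ord_inj ord_pos] := real_rank pos.
apply: chromatic_number_le; apply: (hc _ _ (@meets_sym _ _ F) _ ord ord_inj).
- exact: (grounded_escape gF Fpos ord_pos).
- exact: (grounded_ray gF Fpos ord_pos).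
- exact: (@clique_numberP (intersection_graph F)).
Qed.

Lemma isomorphic_chromatic (G H : sgraph) :
  isomorphic G H -> (chromatic_number G <= chromatic_number H)%N.
Proof.
move=> [h _ hE]; rewrite /chromatic_number.
case: ex_minnP => m _ mmin; case: ex_minnP => n /existsP[c cP] _; apply: mmin.
apply/existsP; exists [ffun x => c (h x)].
apply/forallP => x; apply/forallP => y; rewrite !ffunE -hE.
by move/forallP: cP => /(_ (h x)) /forallP /(_ (h y)).
Qed.

Lemma isomorphic_clique (G H : sgraph) :
  isomorphic G H -> (clique_number H <= clique_number G)%N.
Proof.
move=> [h [h' h'K hK] hE]; apply/bigmax_leqP => K cK.
rewrite -(card_imset (mem K) (can_inj hK)).
apply: (leq_bigmax_cond (F := fun K : {set G} => #|K|)).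
apply/forall_inP => _ /imsetP[x xK ->]; apply/forall_inP => _ /imsetP[y yK ->].
rewrite (inj_eq (can_inj hK)) -hE !hK.
by move/forall_inP: cK => /(_ x xK) /forall_inP /(_ y yK).
Qed.

Theorem mainTheorem1 (R : realType) :
  chi_bounded (outerstring R) /\
  (forall k : nat, (1 <= k)%N ->
    exists Ck : nat,
      forall (T : finType) (F : T -> set (R * R)),
        grounded F ->
        (clique_number (intersection_graph F) <= k)%N ->
        (chromatic_number (intersection_graph F) <= Ck)%N).
Proof.
split; last by case=> // k _; apply: grounded_bounded.
(* Here [f k] is a bound for clique number at most [k.+1], hence also for [k], which covers clique
   number 0. *)
have /choice[f hf] := grounded_bounded R.
exists f => G [T [F [gF iso]]].
apply: leq_trans (isomorphic_chromatic iso) _; apply: hf => //.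
exact: leqW (isomorphic_clique iso).
Qed.
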